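(* Let $\mathcal{C}$ be the class of all bivariate copulas and let $\tau$, $\phi$, $\beta$ denote Kendall's tau, Spearman's footrule and Blomqvist's beta, respectively. For real numbers $b,p$ put $$L(b)=\tfrac{3}{16}(1+b)^2-\tfrac12,\qquad U(b)=1-\tfrac38(1-b)^2,\qquad \ell(p)=\tfrac43 p-\tfrac13,\qquad u(p)=\tfrac23 p+\tfrac13 .$$ A triple $(t,p,b)\in\mathbb{R}^3$ equals $(\tau(C),\phi(C),\beta(C))$ for some copula $C\in\mathcal{C}$ if and only if $-1\le b\le 1$, $L(b)\le p\le U(b)$ and $\ell(p)\le t\le u(p)$. That is, $$\{(\tau(C),\phi(C),\beta(C)):C\in\mathcal{C}\}=\bigl\{(t,p,b)\in\mathbb{R}^3:\ -1\le b\le 1,\ L(b)\le p\le U(b),\ \ell(p)\le t\le u(p)\bigr\}.$$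
   Context: A (bivariate) copula is a distribution function $C$ on $[0,1]^2$ with uniform marginals; it induces a probability measure on $[0,1]^2$, and integrals $\int \cdot\,\mathrm{d}C$ are Lebesgue--Stieltjes integrals with respect to this measure. For a copula $C$: Kendall's tau is $\tau(C)=4\int_{[0,1]^2}C(u,v)\,\mathrm{d}C(u,v)-1$; Spearman's footrule is $\phi(C)=6\int_0^1 C(u,u)\,\mathrm{d}u-2$; Blomqvist's beta is $\beta(C)=4C(\tfrac12,\tfrac12)-1$. *)

(* Defs.v *)
From HB Require Import structures.
From mathcomp Require Import all_boot all_order all_algebra.
From mathcomp Require Import all_classical all_reals all_analysis.

Set Implicit Arguments.
Unset Strict Implicit.
Unset Printing Implicit Defensive.

Import Order.TTheory GRing.Theory Num.Theory.
Import numFieldNormedType.Exports.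

Local Open Scope classical_set_scope.
Local Open Scope ring_scope.

Definition unit_square {R : realType} : set (R * R) :=
  `[0, 1]%classic `*` `[0, 1]%classic.

(* [C] is the distribution function of [P], a probability carried by the unit
   square.  Only the values of [C] on the unit square are constrained (and only
   those are used below). *)
Definition distribution_function_of (R : realType)
    (P : probability (R * R)%type R) (C : R -> R -> R) : Prop :=
  P unit_square = 1%E /\
  forall u v : R, 0 <= u <= 1 -> 0 <= v <= 1 ->
    P (`[0, u]%classic `*` `[0, v]%classic) = (C u v)%:E.

Record copula (R : realType) := Copula {
  copula_fun :> R -> R -> R;
  copula_df : exists P : probability (R * R)%type R,
    distribution_function_of P copula_fun;
  copula_marginal1 : forall u : R, 0 <= u <= 1 -> copula_fun u 1 = u;
  copula_marginal2 : forall v : R, 0 <= v <= 1 -> copula_fun 1 v = v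
}.

(* The choice is harmless: see [copula_measure_unique]. *)
Definition copula_measure (R : realType) (C : copula R) :
    probability (R * R)%type R :=
  projT1 (cid (copula_df C)).

Definition kendall_tau (R : realType) (C : copula R) : R :=
  4 * (\int[copula_measure C]_(x in unit_square) C x.1 x.2) - 1.

Definition spearman_footrule (R : realType) (C : copula R) : R :=
  6 * (\int[@lebesgue_measure R]_(u in `[0, 1]) C u u) - 2.

Definition blomqvist_beta (R : realType) (C : copula R) : R :=
  4 * C 2^-1 2^-1 - 1.

Definition footrule_lower (R : realType) (b : R) : R :=
  3 / 16 * (1 + b) ^+ 2 - 1 / 2.

Definition footrule_upper (R : realType) (b : R) : R :=
  1 - 3 / 8 * (1 - b) ^+ 2.

Definition tau_lower (R : realType) (p : R) : R := 4 / 3 * p - 1 / 3.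

Definition tau_upper (R : realType) (p : R) : R := 2 / 3 * p + 1 / 3.

Lemma copula_measureP (R : realType) (C : copula R) :
  distribution_function_of (copula_measure C) C.
Proof. exact: projT2 (cid (copula_df C)). Qed.

Section uniqueness.
Variable R : realType.

Let quadrants : set (set (R * R)) :=
  [set X | exists a b : R, X = `]-oo, a]%classic `*` `]-oo, b]%classic].

Let rays : set (set R) := [set A | exists a : R, A = `]-oo, a]%classic].

Let measurable_rays : @measurable _ R = <<s rays >>.
Proof.
rewrite eqEsubset; split => A; last first.
  apply: smallest_sub; first exact: sigma_algebra_measurable.
  by move=> _ [a ->]; exact: measurable_itv.
rewrite [measurable _](_ : _ = (@measurable_realfun.RGenOInfty.G R).-sigma.-measurable A); last first.
  by rewrite -measurable_realfun.RGenOInfty.measurableE.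
apply: smallest_sub; first exact: smallest_sigma_algebra.
move=> _ [a ->]; rewrite -setCitvl.
apply: (@measurableC _ (g_sigma_algebraType rays)).
by apply: sub_sigma_algebra; exists a.
Qed.

Let natr_cover (x : R) : exists n : nat, x <= n%:R.
Proof.
exists (Num.bound `|x|); apply: (le_trans (ler_norm x)).
by apply/ltW/archi_boundP.
Qed.

Let measurable_quadrants : @measurable _ (R * R)%type = <<s quadrants >>.
Proof.
rewrite eqEsubset; split => A; last first.
  apply: smallest_sub; first exact: sigma_algebra_measurable.
  by move=> _ [a [b ->]]; apply: measurableX; exact: measurable_itv.
apply: smallest_sub; first exact: smallest_sigma_algebra.
rewrite subUset; split.
- rewrite measurable_rays -g_sigma_preimageE.
  apply: smallest_sub; first exact: smallest_sigma_algebra.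
  move=> _ [_ [a ->] <-]; rewrite setTI.
  have -> : fst @^-1` `]-oo, a]%classic =
      \bigcup_n (`]-oo, a]%classic `*` `]-oo, (n%:R : R)]%classic).
    apply/seteqP; split => [[x y] /= xa|[x y] [n _ [] //]].
    by have [n yn] := natr_cover y; exists n => //; split; rewrite //= in_itv.
  apply: (@bigcupT_measurable _ (g_sigma_algebraType quadrants)) => n.
  by apply: sub_sigma_algebra; exists a, n%:R.
- rewrite measurable_rays -g_sigma_preimageE.
  apply: smallest_sub; first exact: smallest_sigma_algebra.
  move=> _ [_ [a ->] <-]; rewrite setTI.
  have -> : snd @^-1` `]-oo, a]%classic =
      \bigcup_n (`]-oo, (n%:R : R)]%classic `*` `]-oo, a]%classic).
    apply/seteqP; split => [[x y] /= xa|[x y] [n _ [] //]].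
    by have [n yn] := natr_cover x; exists n => //; split; rewrite //= in_itv.
  apply: (@bigcupT_measurable _ (g_sigma_algebraType quadrants)) => n.
  by apply: sub_sigma_algebra; exists n%:R, a.
Qed.

Let ray_trace (a : R) : `]-oo, a]%classic `&` `[0, 1]%classic = set0 \/
  exists2 u : R, 0 <= u <= 1 &
    `]-oo, a]%classic `&` `[0, 1]%classic = `[0, u]%classic.
Proof.
have [a0|a0] := ltP a 0.
  left; apply/seteqP; split => // x [/=]; rewrite !in_itv /= => xa /andP[x0 _].
  by move: (lt_le_trans a0 x0); rewrite ltNge xa.
right; exists (Num.min a 1); first by rewrite le_min a0 ler01 ge_min lexx orbT.
apply/seteqP; split => x /=; rewrite !in_itv /= le_min.
  by move=> [-> /andP[-> ->]].
by move=> /and3P[-> -> ->].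
Qed.

Lemma copula_measure_unique (C : copula R) (P : probability (R * R)%type R) :
  distribution_function_of P C ->
  forall A : set (R * R), measurable A -> copula_measure C A = P A.
Proof.
move=> PC; have QC := copula_measureP C.
have mI : measurable (unit_square : set (R * R)).
  by apply: measurableX; exact: measurable_itv.
have trace (Q : probability (R * R)%type R) (X : set (R * R)) : measurable X ->
    Q unit_square = 1%E -> Q X = Q (X `&` unit_square).
  move=> mX QI; rewrite [LHS](measureDI Q mX mI).
  rewrite [X in (X + _)%E = _](_ : _ = 0%E) ?add0e//.
  apply: (@subset_measure0 _ _ _ _ _ (~` unit_square)) => //.
  - exact: measurableD.
  - exact: measurableC.
  - by have := probability_setC Q mI; rewrite QI subee.
apply: (measure_unique quadrants
  (fun n : nat => `]-oo, (n%:R : R)]%classic `*` `]-oo, (n%:R : R)]%classic)).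
- exact: measurable_quadrants.
- move=> _ _ [a [b ->]] [c [d ->]]; exists (Num.min a c), (Num.min b d).
  rewrite -setXI; congr (_ `*` _); apply/seteqP;
    split => x /=; rewrite !in_itv /= le_min; first [by move=> [-> ->]|by move=> /andP[]].
- by move=> n; exists n%:R, n%:R.
- apply/seteqP; split => // -[x y] _.
  have [n xyn] := natr_cover (Num.max x y).
  by exists n => //; move: xyn; rewrite ge_max => /andP[? ?]; split; rewrite /= in_itv.
- move=> _ [a [b ->]].
  have mab : measurable (`]-oo, a]%classic `*` `]-oo, b]%classic).
    by apply: measurableX; exact: measurable_itv.
  have [QI QE] := QC; have [PI PE] := PC.
  rewrite [LHS](trace _ _ mab QI) [RHS](trace _ _ mab PI) /unit_square -setXI.
  have [->|[u u01 ->]] := ray_trace a; first by rewrite set0X !measure0.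
  have [->|[v v01 ->]] := ray_trace b; first by rewrite setX0 !measure0.
  by rewrite [LHS]QE// [RHS]PE.
- by move=> n; apply: (le_lt_trans (probability_le1 _ _)); rewrite ?ltry//;
    apply: measurableX; exact: measurable_itv.
Qed.

End uniqueness.

(* Main.v *)
(* The three functionals only depend on the diagonal section delta(u) = C(u,u),
   on delta(1/2) and on the integral of C against its own measure.

   Necessity.  delta is nondecreasing and 2-Lipschitz with
   max(0, 2u - 1) <= delta(u) <= u, so delta(1/2) confines delta between two
   piecewise affine functions; this bounds the footrule.  For Kendall's tau,
   C(u,v) <= min(u,v) and C(u,v) >= min(u,v) - v + delta(v) pointwise, and
   integrating min(U,V) and delta(V) against C gives int delta in both cases
   (U and V being uniform), so 2 int delta - 1/2 <= int C dC <= int delta.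

   Sufficiency.  The lower bound on tau is attained by the law of (S, f(S)), S
   uniform and f a nested system of reflections with two parameters, which
   realizes every admissible pair (beta, footrule).  Given any diagonal delta,
   the upper bound is attained by the diagonal copula
   (min(2u - delta(u), delta(v)) + min(2v - delta(v), delta(u))) / 2, whose
   measure is the half-half mixture of the laws of (q(S), r(S)) and (r(S), q(S))
   for q, r right inverses of 2u - delta(u) and delta.  On mixtures of these two
   copulas, which share delta, tau is a polynomial in the weight, and the
   intermediate value theorem concludes. *)

Require Import Defs.
From HB Require Import structures.
From mathcomp Require Import all_boot all_order all_algebra.
From mathcomp Require Import all_classical all_reals all_analysis.
From mathcomp Require Import measurable_realfun.
From mathcomp Require Import ring lra.
Set Implicit Arguments.
Unset Strict Implicit.
Unset Printing Implicit Defensive.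

Import Order.TTheory GRing.Theory Num.Theory.
Import numFieldNormedType.Exports.
Local Open Scope classical_set_scope.
Local Open Scope ring_scope.

(** * Images of probabilities and integrability of bounded functions *)

Definition law d d' (T : measurableType d) (T' : measurableType d')
    (R : realType) (P : probability T R) (f : T -> T')
    (mf : measurable_fun setT f) : probability T' R :=
  distribution P (HB.pack f (isMeasurableFun.Build _ _ _ _ f mf)
    : {mfun T >-> T'}).

Lemma integrable_bounded d (T : measurableType d) (R : realType)
    (mu : {measure set T -> \bar R}) (A : set T) (f : T -> R) (M : R) :
  measurable A -> (mu A < +oo)%E -> measurable_fun A f ->
  (forall x, A x -> `|f x| <= M) -> mu.-integrable A (EFin \o f).
Proof.
move=> mA Aoo mf fM; apply: measurable_bounded_integrable => //.
exists M; split; first exact: num_real.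
by move=> N MN x Ax; exact: le_trans (fM x Ax) (ltW MN).
Qed.

(** * Distribution functions of probabilities on the unit square *)

Section copula_probability.
Variable R : realType.
Notation leb := (@lebesgue_measure R).
Local Notation D := (@unit_square R).
Implicit Type P : probability (R * R)%type R.

Lemma measurable_unit_square : measurable D.
Proof. by apply: measurableX; exact: measurable_itv. Qed.

Definition cdf2 P (u v : R) : R := fine (P (`[0, u]%classic `*` `[0, v]%classic)).

Definition uniform_marginals P : Prop :=
  P D = 1%E /\ forall u, 0 <= u <= 1 -> cdf2 P u 1 = u /\ cdf2 P 1 u = u.

Lemma measurable_box (a b c d : bool) (u u' v v' : R) :
  measurable ([set` Interval (BSide a u) (BSide b u')] `*`
              [set` Interval (BSide c v) (BSide d v')] : set (R * R)).
Proof. by apply: measurableX; exact: measurable_itv. Qed.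

Lemma cdf2E P u v : P (`[0, u]%classic `*` `[0, v]%classic) = (cdf2 P u v)%:E.
Proof. by rewrite fineK//; apply: fin_num_measure; exact: measurable_box. Qed.

Lemma fine_probability_le P (A B : set (R * R)) : measurable A -> measurable B ->
  A `<=` B -> fine (P A) <= fine (P B).
Proof.
move=> mA mB AB; apply: fine_le; rewrite ?fin_num_measure//.
by apply: le_measure; rewrite ?inE.
Qed.

Lemma fine_probabilityU P (A B : set (R * R)) : measurable A -> measurable B ->
  A `&` B = set0 -> fine (P (A `|` B)) = fine (P A) + fine (P B).
Proof. by move=> mA mB AB; rewrite measureU// fineD ?fin_num_measure. Qed.

Definition swap_law P : probability (R * R)%type R :=
  law P (measurable_fun_pair measurable_snd measurable_fst).

Lemma cdf2_swap P u v : cdf2 (swap_law P) u v = cdf2 P v u.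
Proof.
rewrite /cdf2; congr (fine (P _)).
by apply/seteqP; split => -[x y] /= [].
Qed.

Section marginals.
Variable P : probability (R * R)%type R.
Hypothesis PU : uniform_marginals P.

Lemma uniform_marginals_swap : uniform_marginals (swap_law P).
Proof.
case: PU => PD PM; split.
  rewrite -PD; congr (P _).
  by apply/seteqP; split => -[x y] /= [].
by move=> u u01; rewrite !cdf2_swap; have [] := PM u u01.
Qed.

Lemma trace_unit_square (A : set (R * R)) : measurable A -> P A = P (A `&` D).
Proof.
have mD := measurable_unit_square.
move=> mA; rewrite [LHS](measureDI P mA mD).
rewrite [X in (X + _)%E = _](_ : _ = 0%E) ?add0e//.
apply: (@subset_measure0 _ _ _ _ _ (~` D)) => //.
- exact: measurableD.
- exact: measurableC.
- by rewrite [LHS]probability_setC// PU.1 subee.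
Qed.

(** The increment is the mass of the strip []u, u'] x [0, v]], contained in the full strip []u, u']
    x [0, 1]], whose mass is given by the uniform first marginal. *)
Lemma cdf2_lip u u' v : 0 <= u -> u <= u' -> u' <= 1 -> 0 <= v <= 1 ->
  0 <= cdf2 P u' v - cdf2 P u v <= u' - u.
Proof.
move=> u0 uu' u'1 /andP[v0 v1].
have split (w : R) : cdf2 P u' w = cdf2 P u w +
    fine (P (`]u, u']%classic `*` `[0, w]%classic)).
  rewrite -fine_probabilityU; try exact: measurable_box.
    congr (fine (P _)); apply/seteqP; split => -[x y] /=; rewrite !in_itv/=.
      move=> [xu' yw]; have [xu|xu] := leP x u; [left|right];
        split => /=; lra.
    by case=> -[xu yw]; split; lra.
  apply/seteqP; split => // -[x y] /= [[+ _] [+ _]]; rewrite /= !in_itv/=; lra.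
rewrite split addrC addKr fine_ge0//=.
have := split 1; have [-> _] := PU.2 u' (introT andP (conj (le_trans u0 uu') u'1)).
have [-> _] := PU.2 u (introT andP (conj u0 (le_trans uu' u'1))).
have : fine (P (`]u, u'] `*` `[0, v])) <= fine (P (`]u, u'] `*` `[0, 1])).
  apply: fine_probability_le; try exact: measurable_box.
  by move=> [x y] /=; rewrite !in_itv/= => -[? ?]; split; lra.
lra.
Qed.

Lemma cdf2_ge0 u v : 0 <= cdf2 P u v.
Proof. exact: fine_ge0. Qed.

Lemma cdf2_le1 u v : cdf2 P u v <= 1.
Proof.
by rewrite -[leRHS]/(fine 1%:E) fine_le ?fin_num_measure//;
  [exact: measurable_box|apply: probability_le1; exact: measurable_box].
Qed.
End marginals.

Lemma cdf2_lip2 P u v v' : uniform_marginals P ->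
  0 <= v -> v <= v' -> v' <= 1 -> 0 <= u <= 1 ->
  0 <= cdf2 P u v' - cdf2 P u v <= v' - v.
Proof.
move=> /uniform_marginals_swap PU v0 vv' v'1 u01.
by have := cdf2_lip PU v0 vv' v'1 u01; rewrite !cdf2_swap.
Qed.

Lemma cdf2_0l P v : uniform_marginals P -> 0 <= v <= 1 -> cdf2 P 0 v = 0.
Proof.
move=> PU v01; have [v0 v1] := andP v01; have := cdf2_lip2 PU v0 v1 (lexx 1) (u := 0).
have [|-> _] := PU.2 0; first by rewrite lexx ler01.
by rewrite lexx ler01 => /(_ isT); have := cdf2_ge0 P 0 v; lra.
Qed.

End copula_probability.

(** * Measurability of the distribution function and law of the second coordinate *)

Section diagonal_section.
Variable R : realType.
Notation leb := (@lebesgue_measure R).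
Local Notation D := (@unit_square R).
Implicit Type P : probability (R * R)%type R.

(** The boxes [[0, u] x [0, v]] are the sections of the single measurable set [S], and the mass of a
    section is a measurable function of its base point. *)
Lemma measurable_cdf2 P :
  measurable_fun [set: R * R] (fun x : R * R => cdf2 P x.1 x.2).
Proof.
pose S := [set z : (R * R) * (R * R) | (0 <= z.2.1 <= z.1.1) && (0 <= z.2.2 <= z.1.2)].
have mS : measurable S.
  suff : measurable_fun setT (fun z : (R * R) * (R * R) =>
      (0 <= z.2.1 <= z.1.1) && (0 <= z.2.2 <= z.1.2)).
    by move=> /(_ measurableT [set true] I); rewrite setTI; apply.
  by repeat apply: measurable_and; apply: measurable_fun_ler;
    do ?[exact: measurable_cst | apply: measurableT_comp => //].
apply: (eq_measurable_fun (fine \o (P \o xsection S))).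
  move=> [u v] _; rewrite /= /cdf2; congr (fine (P _)).
  apply/seteqP; split => -[x y]; rewrite /xsection /= inE /S /= !in_itv/=.
    by move=> /andP[].
  by move=> -[-> ->].
apply: (measurableT_comp (f := fine)); first exact: fine_measurable.
exact: (@measurable_fun_xsection _ _ _ _ R P).
Qed.

(** The open rays form a pi-system generating the Borel sets; their masses follow from those of the
    closed rays by complement. *)
Lemma eq_probability_rays (P Q : probability R R) :
  (forall a, P `]-oo, a]%classic = Q `]-oo, a]%classic) ->
  forall A, measurable A -> P A = Q A.
Proof.
move=> PQ A mA; apply: (@measure_unique _ R R (@RGenOInfty.G R)
  (fun n : nat => `](- n%:R : R), +oo[%classic) _ _ _ _ P Q) => //.
- exact: RGenOInfty.measurableE.
- move=> _ _ [a ->] [b ->]; exists (Num.max a b).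
  by apply/seteqP; split => x /=; rewrite !in_itv/= !andbT gt_max => /andP.
- by move=> n; exists (- n%:R).
- apply/seteqP; split => // x _.
  exists (Num.bound `|x|) => //=; rewrite in_itv/= andbT ltrNl.
  by apply: le_lt_trans (archi_boundP (normr_ge0 x)); rewrite -normrN ler_norm.
- move=> _ [a ->]; rewrite -setCitvl.
  by rewrite [LHS]probability_setC// [RHS]probability_setC// PQ.
- by move=> n; rewrite (le_lt_trans (probability_le1 _ _)) ?ltry.
Qed.

(* [uniform_prob] lives on [measurableTypeR R]; its image by the identity lives
   on the measurable structure of [R] that underlies [R * R]. *)
Definition unif : probability R R :=
  @law _ _ (measurableTypeR R) R R (uniform_prob (@ltr01 R)) id
    (@measurable_id _ (measurableTypeR R) setT).

Lemma unifE (A : set R) : measurable A -> unif A = leb (A `&` `[0, 1]%classic).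
Proof.
move=> mA; rewrite [LHS]integral_uniform_pdf.
under eq_integral => x.
  rewrite inE => -[_ /= x01]; rewrite /uniform_pdf ifT; last by [].
  rewrite subr0 invr1; over.
by rewrite integral_cst ?mul1e//; exact: measurableI.
Qed.

Lemma integral_unif (g : R -> \bar R) : measurable_fun setT g ->
  (forall x, 0 <= x <= 1 -> (0 <= g x)%E) ->
  (\int[unif]_(x in `[0%R, 1%R]) g x = \int[leb]_(x in `[0%R, 1%R]) g x)%E.
Proof.
move=> mg g0; rewrite [LHS]ge0_integral_pushforward//=; last 2 first.
- exact: measurable_funTS.
- by move=> y /set_mem /=; rewrite in_itv/=; exact: g0.
apply: eq_measure_integral => A mA A01.
by rewrite -[LHS]/(unif A) unifE// setIidl.
Qed.

Lemma leb_itv01 (a b : R) (x y : bool) : a <= b ->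
  leb [set` Interval (BSide x a) (BSide y b)] = (b - a)%:E.
Proof.
move=> ab; rewrite lebesgue_measure_itv /= lte_fin; case: ltP => //.
by move=> ba; rewrite (@le_anti _ _ a b) ?ab// subrr.
Qed.

Section marginals.
Variable P : probability (R * R)%type R.
Hypothesis PU : uniform_marginals P.

(** By [eq_probability_rays] it is enough to treat rays. The square cuts the preimage of a ray down
    to the empty set or to the box [[0, 1] x [0, b]] with [b = min(a, 1)], of mass [b]. *)
Lemma marginal2 (A : set R) : measurable A -> P (snd @^-1` A) = unif A.
Proof.
move=> mA; rewrite -[LHS]/(law P measurable_snd A); move: A mA.
apply: eq_probability_rays => a; rewrite unifE; last exact: measurable_itv.
rewrite [LHS](trace_unit_square PU); last first.
  by rewrite -[X in measurable X]setTI; exact: measurable_snd.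
have [a0|a0] := ltP a 0.
  rewrite [X in P X](_ : _ = set0) ?[X in leb X](_ : _ = set0) ?measure0//.
    by apply/seteqP; split => // x /=; rewrite !in_itv/=; lra.
  by apply/seteqP; split => // -[x y] [/= + [_ /=]]; rewrite !in_itv/=; lra.
pose b := Num.min a 1.
have b01 : 0 <= b <= 1 by rewrite /b le_min a0 ler01 ge_min lexx orbT.
transitivity (cdf2 P 1 b)%:E.
  rewrite -cdf2E; congr (P _); apply/seteqP.
  split => -[x y] /=; rewrite !in_itv/= /b le_min.
    by move=> [ya [/=]]; rewrite !in_itv/= => x01 /andP[y0 y1]; rewrite x01 y0 ya y1.
  by move=> [x01 /and3P[y0 ya y1]]; split => //; split => /=; rewrite in_itv/= ?y0.
rewrite (PU.2 b b01).2 [X in leb X](_ : _ = `[0, b]%classic).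
  by rewrite leb_itv01 ?subr0//; case/andP: b01.
apply/seteqP; split => x /=; rewrite !in_itv/= /b le_min.
  by move=> [xa /andP[x0 x1]]; rewrite x0 xa x1.
by move=> /and3P[x0 xa x1]; rewrite x0 xa x1.
Qed.

Lemma integral_marginal2 (g : R -> R) : measurable_fun setT g ->
  (forall x, 0 <= x <= 1 -> 0 <= g x) ->
  \int[P]_(x in D) g x.2 = \int[leb]_(x in `[0, 1]) g x.
Proof.
move=> mg g0; rewrite /Rintegral; congr fine.
rewrite -integral_unif; last 2 first.
- exact/measurable_EFinP.
- by move=> x x01; rewrite lee_fin g0.
transitivity (\int[law P measurable_snd]_(x in `[0%R, 1%R]) (g x)%:E)%E; last first.
  by apply: eq_measure_integral => A mA A01; rewrite [LHS]marginal2.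
rewrite [RHS]ge0_integral_pushforward//=; last 2 first.
- by apply/measurable_EFinP; exact: measurable_funS mg.
- by move=> y /set_mem /=; rewrite in_itv/= lee_fin; exact: g0.
have mS : measurable (snd @^-1` `[0, 1]%classic : set (R * R)).
  by rewrite -[X in measurable X]setTI; exact: measurable_snd.
(* The domain is now a strip wider than the square; the excess is null. *)
rewrite [RHS](@ge0_negligible_integral _ _ R P _ (~` D)) //=.
- congr (integral _ _ _); apply/seteqP; split => -[x y] /=.
    by move=> Dxy; split=> //; case: Dxy.
  by move=> [_ /contrapT].
- by apply: measurableC; exact: (@measurable_unit_square R).
- apply/measurable_EFinP; apply: measurable_funTS.
  exact: (measurableT_comp mg measurable_snd).
- by move=> x; rewrite in_itv/= lee_fin; exact: g0.
- by rewrite [LHS]probability_setC ?PU.1 ?subee//; exact: measurable_unit_square.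
Qed.

End marginals.
End diagonal_section.

(** * Integrals of piecewise affine functions *)

Section affine_integrals.
Variable R : realType.
Notation leb := (@lebesgue_measure R).

Lemma integral_affine (a b alpha beta : R) : a <= b ->
  \int[leb]_(x in `[a, b]) (alpha * x + beta) =
  (b - a) * (alpha * (a + b) / 2 + beta).
Proof.
rewrite le_eqVlt => /predU1P[<-|ab].
  by rewrite set_itv1 Rintegral_set1 subrr mul0r.
pose p := (alpha / 2) *: 'X^2 + beta *: 'X : {poly R}.
rewrite /Rintegral (@continuous_FTC2 _ _ (horner p)) //.
- by rewrite -EFinB /p /= !(hornerD, hornerZ, hornerXn, hornerX); field.
- apply: continuous_subspaceT => x.
  by apply: cvgD; [apply: cvgM; [exact: cvg_cst|]|exact: cvg_cst].
- split=> [x _| |]; first exact: derivable_horner.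
  + by apply: cvg_at_right_filter; exact: continuous_horner.
  + by apply: cvg_at_left_filter; exact: continuous_horner.
- move=> x _; rewrite -derivE /p derivD !derivZ derivXn derivX.
  by rewrite !(hornerD, hornerZ, hornerXn, hornerX, hornerC, hornerMn) expr1; field.
Qed.

Section bounded_function.
Variables (f : R -> R) (M : R).
Hypotheses (mf : measurable_fun setT f)
  (fM : forall x, 0 <= x <= 1 -> `|f x| <= M).

Lemma integrable_unit_itv (a b : bool) (x y : R) : 0 <= x -> y <= 1 ->
  leb.-integrable [set` Interval (BSide a x) (BSide b y)] (EFin \o f).
Proof.
move=> x0 y1; apply: (@integrable_bounded _ _ R leb _ _ M).
- exact: measurable_itv.
- by rewrite [ltLHS]lebesgue_measure_itv /=; case: ifP => _; rewrite -?EFinD ltry.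
- exact: measurable_funTS.
- move=> z /=; rewrite itv_boundlr => /andP[xz zy]; apply: fM.
  by case: a b xz zy => -[]; rewrite !bnd_simp => ? ?; lra.
Qed.

Lemma integral_split (a b c : R) : 0 <= a -> a <= b -> b <= c -> c <= 1 ->
  \int[leb]_(x in `[a, c]) f x =
  \int[leb]_(x in `[a, b]) f x + \int[leb]_(x in `[b, c]) f x.
Proof.
move=> a0 ab bc c1; have b0 := le_trans a0 ab.
rewrite -(@Rintegral_itv_obnd_cbnd _ b); last exact: integrable_unit_itv.
rewrite -(@Rintegral_itvB _ _ (BLeft a) (BRight c) b) ?bnd_simp//.
  by rewrite addrC subrK.
exact: integrable_unit_itv.
Qed.

(** Only the open interval is tested, because the endpoints are null; piecewise formulas may then
    disagree at their breakpoints. *)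
Lemma integral_le_affine (a b alpha beta : R) : 0 <= a -> a <= b -> b <= 1 ->
  (forall x, a < x < b -> f x <= alpha * x + beta) ->
  \int[leb]_(x in `[a, b]) f x <= (b - a) * (alpha * (a + b) / 2 + beta).
Proof.
move=> a0 ab b1 fle; rewrite -integral_affine//.
have iaff : leb.-integrable `[a, b] (EFin \o (fun x => alpha * x + beta)).
  apply: continuous_compact_integrable; first exact: segment_compact.
  apply: continuous_subspaceT => x.
  by apply: cvgD; [apply: cvgM; [exact: cvg_cst|]|exact: cvg_cst].
rewrite -!(@Rintegral_itv_obnd_cbnd _ a (BRight b)); last 2 first.
- by apply: integrableS iaff => //; exact: subset_itv_oc_cc.
- exact: integrable_unit_itv.
rewrite -!(@Rintegral_itv_bndo_bndc _ (BRight a) b); last 2 first.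
- by apply: integrableS iaff => //; exact: subset_itv_oo_cc.
- exact: integrable_unit_itv.
apply: le_Rintegral => //.
- exact: integrable_unit_itv.
- by apply: integrableS iaff => //; exact: subset_itv_oo_cc.
Qed.
End bounded_function.

Section bounded_function_ge.
Variables (f : R -> R) (M : R).
Hypotheses (mf : measurable_fun setT f)
  (fM : forall x, 0 <= x <= 1 -> `|f x| <= M).

(** The upper bound applied to [- f]; the new section makes [integral_le_affine] available for
    functions other than [f]. *)
Lemma integral_ge_affine (a b alpha beta : R) : 0 <= a -> a <= b -> b <= 1 ->
  (forall x, a < x < b -> alpha * x + beta <= f x) ->
  (b - a) * (alpha * (a + b) / 2 + beta) <= \int[leb]_(x in `[a, b]) f x.
Proof.
move=> a0 ab b1 fge; rewrite -lerN2 -mulN1r -RintegralZl//; last first.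
  exact: (integrable_unit_itv mf fM).
rewrite [leRHS](_ : _ = (b - a) * ((- alpha) * (a + b) / 2 + (- beta))); last by field.
apply: (@integral_le_affine _ M) => //.
- exact: measurable_funM.
- by move=> x x01; rewrite normrM normrN1 mul1r fM.
- by move=> x xab; rewrite mulN1r mulNr -opprD lerN2 fge.
Qed.

Lemma integral_eq_affine (a b alpha beta : R) : 0 <= a -> a <= b -> b <= 1 ->
  (forall x, a < x < b -> f x = alpha * x + beta) ->
  \int[leb]_(x in `[a, b]) f x = (b - a) * (alpha * (a + b) / 2 + beta).
Proof.
move=> a0 ab b1 fE; apply/eqP; rewrite eq_le integral_ge_affine ?andbT//.
  by apply: (@integral_le_affine _ M) => // x /fE ->.
by move=> x /fE ->.
Qed.
End bounded_function_ge.
End affine_integrals.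

(** * Bounds on Kendall's tau *)

Section concordance_bounds.
Variable R : realType.
Notation leb := (@lebesgue_measure R).
Local Notation D := (@unit_square R).
Variable P : probability (R * R)%type R.
Hypothesis PU : uniform_marginals P.

Definition diagonal_integral := \int[leb]_(u in `[0, 1]) cdf2 P u u.
Definition concordance_integral := \int[P]_(x in D) cdf2 P x.1 x.2.

Lemma measurable_diagonal : measurable_fun [set: R] (fun u => cdf2 P u u).
Proof.
apply: (@measurableT_comp _ _ _ R (R * R)%type R _ setT (fun u => (u, u))
  (measurable_cdf2 P)).
exact: measurable_fun_pair.
Qed.

Lemma normr_cdf2 u v : `|cdf2 P u v| <= 1.
Proof. by rewrite ger0_norm ?cdf2_le1// cdf2_ge0. Qed.

Lemma integrable_unit_square (f : R * R -> R) (M : R) :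
  measurable_fun setT f -> (forall x, D x -> `|f x| <= M) ->
  P.-integrable D (EFin \o f).
Proof.
move=> mf fM; apply: (@integrable_bounded _ _ _ _ _ _ M) => //.
- exact: measurable_unit_square.
- by rewrite [ltLHS]PU.1 ltry.
- exact: measurable_funTS.
Qed.

(** Inclusion-exclusion. This is the survival function of the minimum of the two coordinates. *)
Lemma strict_quadrant (r : R) : 0 <= r <= 1 ->
  P [set x | (r < x.1) && (r < x.2)] = (1 - 2 * r + cdf2 P r r)%:E.
Proof.
move=> r01; have [r0 r1] := andP r01.
have mQ : measurable [set x : R * R | (r < x.1) && (r < x.2)].
  rewrite [X in measurable X](_ : _ = `]r, +oo[%classic `*` `]r, +oo[%classic).
    by apply: measurableX; exact: measurable_itv.
  by apply/seteqP; split => -[x y] /=; rewrite !in_itv/= !andbT => /andP.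
rewrite (trace_unit_square PU mQ).
set Q := _ `&` D.
have QE : Q = `]r, 1]%classic `*` `]r, 1]%classic.
  apply/seteqP; split => -[x y]; rewrite /Q /unit_square /= !in_itv/=.
    by move=> [/andP[-> ->] [/andP[_ ->] /andP[_ ->]]].
  by move=> [/andP[rx x1] /andP[ry y1]]; rewrite rx ry x1 y1 !ltW//; lra.
have mB (a b c d : bool) u u' v v' := @measurable_box R a b c d u u' v v'.
(* The square splits into the left strip of mass [r], the box []r, 1] x [0, r]] and [Q]; [E2] finds
   the mass of that box from the bottom strip. *)
have E1 : 1 = r + fine (P (`]r, 1]%classic `*` `[0, r]%classic)) + fine (P Q).
  rewrite QE -{1}(PU.2 r r01).1 -!fine_probabilityU.
  - transitivity (fine (P D)); first by rewrite PU.1.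
    congr (fine (P _)); rewrite /unit_square.
    apply/seteqP; split => -[x y] /=; rewrite !in_itv/=.
      move=> [x01 y01]; have [xr|xr] := leP x r.
        by left; left; split => /=; lra.
      by have [yr|yr] := leP y r; [left; right|right]; split => /=; lra.
    by case => [[]|] [? ?]; split => /=; lra.
  - exact: measurableU.
  - exact: mB.
  - by apply/seteqP; split => // -[x y] /= [[|]]; rewrite !in_itv/=; lra.
  - exact: mB.
  - exact: mB.
  - by apply/seteqP; split => // -[x y] /= []; rewrite !in_itv/=; lra.
have E2 : r = cdf2 P r r + fine (P (`]r, 1]%classic `*` `[0, r]%classic)).
  rewrite -{1}(PU.2 r r01).2 -fine_probabilityU.
  - congr (fine (P _)); apply/seteqP; split => -[x y] /=; rewrite !in_itv/=.
      move=> [x01 y01].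
      by have [xr|xr] := leP x r; [left|right]; split => /=; lra.
    by case => -[? ?]; split => /=; lra.
  - exact: mB.
  - exact: mB.
  - by apply/seteqP; split => // -[x y] /= []; rewrite !in_itv/=; lra.
rewrite -[LHS]fineK; last first.
  by rewrite fin_num_measure// QE; exact: mB.
by congr (_%:E); lra.
Qed.

(** The survival function of the minimum differs from the diagonal section by [1 - 2 * r], whose
    integral over [[0, 1]] is zero. *)
Lemma integral_diagonal_reflection :
  \int[leb]_(r in `[0, 1]) (1 - 2 * r + cdf2 P r r) = diagonal_integral.
Proof.
have maff : measurable_fun [set: R] (fun r : R => 1 - 2 * r).
  by apply: measurable_funB => //; exact: measurable_funM.
rewrite RintegralD//; last 2 first.
- apply: (@integrable_unit_itv _ _ 1 maff) => //.
  by move=> x x01; rewrite ler_norml; lra.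
- apply: (@integrable_unit_itv _ _ 1 measurable_diagonal) => // x _.
  exact: normr_cdf2.
have -> : \int[leb]_(r in `[0, 1]) (1 - 2 * r) = 0.
  rewrite (@integral_eq_affine _ _ 1 maff _ 0 1 (-2) 1)//; try lra.
  - by move=> x x01; rewrite ler_norml; lra.
  - by move=> x _; lra.
by rewrite add0r.
Qed.

Lemma ae_unit_square (f : R * R -> \bar R) : measurable_fun setT f ->
  (forall x, (0 <= f x)%E) -> (\int[P]_(x in D) f x = \int[P]_x f x)%E.
Proof.
move=> mf f0; have mD := @measurable_unit_square R.
rewrite [RHS](@ge0_negligible_integral _ _ R P _ (~` D))//.
- by rewrite setDE setCK setTI.
- exact: measurableC.
- by rewrite [LHS]probability_setC// PU.1 subee.
Qed.

(** The mean of a nonnegative variable is the integral of its survival function, which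
    [strict_quadrant] computes. *)
Lemma integral_min :
  \int[P]_(x in D) Num.min x.1 x.2 = diagonal_integral.
Proof.
(* The tail formula requires nonnegativity everywhere, while the minimum has it only on the square;
   truncation at 0 changes nothing there. *)
pose X (x : R * R) := Num.max 0 (Num.min x.1 x.2).
have mX : measurable_fun setT X.
  by apply: measurable_maxr => //; exact: measurable_minr.
pose XRV : {RV P >-> R} := HB.pack X (isMeasurableFun.Build _ _ _ _ X mX).
transitivity (\int[P]_(x in D) X x).
  apply: eq_Rintegral => x /set_mem[/=]; rewrite !in_itv/= => /andP[x0 _] /andP[y0 _].
  by rewrite /X; apply/esym/max_idPr; rewrite le_min x0.
rewrite -integral_diagonal_reflection /Rintegral; congr fine.
rewrite [LHS]ae_unit_square; last 2 first.
- exact/measurable_EFinP.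
- by move=> x; rewrite lee_fin le_max lexx.
have X0 x : 0 <= X x by rewrite le_max lexx.
have := ge0_expectation_ccdf (X := XRV) X0.
rewrite expectation_def => ->.
have mc := ccdf_measurable XRV.
have c01 r : 0 <= r <= 1 -> ccdf XRV r = (1 - 2 * r + cdf2 P r r)%:E.
  move=> r01; rewrite -strict_quadrant// /ccdf; congr (P _).
  apply/seteqP; split => x; rewrite /= in_itv/= andbT /X lt_max lt_min.
    by have -> : r < 0 = false by apply/negbTE; rewrite -leNgt; lra.
  by move=> ->; rewrite orbT.
rewrite (_ : `[0%R, +oo[%classic = `[0, 1]%classic `|` `]1, +oo[%classic); last first.
  apply/seteqP; split => x /=; rewrite !in_itv/= !andbT; last by case; lra.
  by have [x1|x1] := leP x 1; [left|right] => //; lra.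
rewrite ge0_integral_setU//; last 2 first.
- exact: measurable_funTS.
- by apply/disj_setPS => x [/=]; rewrite !in_itv/=; lra.
(* Beyond 1 the survival function vanishes, since [P] is carried by the square. *)
rewrite [X in (_ + X)%E]integral0_eq ?adde0.
  apply: eq_integral => x /set_mem /=; rewrite in_itv/= => x01; exact: c01.
move=> x; rewrite /= in_itv/= andbT => x1.
have mQ : measurable (X @^-1` `]x, +oo[%classic).
  have := mX measurableT `]x, +oo[%classic (measurable_itv _).
  by rewrite setTI.
rewrite -[LHS]/(P (X @^-1` `]x, +oo[%classic)) (trace_unit_square PU mQ).
rewrite -[RHS](measure0 P); congr (P _); apply/seteqP; split => // -[y z] [/=].
rewrite /X in_itv/= andbT lt_max lt_min => /orP[x0|/andP[xy xz]] Dyz.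
  lra.
have /= := Dyz.1; rewrite in_itv/=; lra.
Qed.

(** Upper Frechet-Hoeffding bound: monotonicity up to the edges of the square, where the marginals
    give [u] and [v]. *)
Lemma cdf2_le_min u v : 0 <= u <= 1 -> 0 <= v <= 1 -> cdf2 P u v <= Num.min u v.
Proof.
move=> u01 v01; have [u0 u1] := andP u01; have [v0 v1] := andP v01.
rewrite le_min; have [cu _] := PU.2 u u01; have [_ cv] := PU.2 v v01.
have := cdf2_lip2 PU v0 v1 (lexx 1) u01.
have := cdf2_lip PU u0 u1 (lexx 1) v01.
by rewrite cu cv => ? ?; apply/andP; split; lra.
Qed.

(** For [u <= v] the first variable costs at most [v - u]; for [v <= u] the left side is
    [cdf2 P v v] and monotonicity suffices. *)
Lemma cdf2_ge_diagonal u v : 0 <= u <= 1 -> 0 <= v <= 1 ->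
  Num.min u v - v + cdf2 P v v <= cdf2 P u v.
Proof.
move=> u01 v01; have [u0 u1] := andP u01; have [v0 v1] := andP v01.
have [uv|/ltW vu] := leP u v.
  have := cdf2_lip PU u0 uv v1 v01; lra.
have := cdf2_lip PU v0 vu u1 v01; lra.
Qed.

Definition concordance_minorant (x : R * R) :=
  Num.min x.1 x.2 - x.2 + cdf2 P x.2 x.2.

Lemma measurable_minimum :
  measurable_fun setT (fun x : R * R => Num.min x.1 x.2).
Proof. exact: measurable_minr. Qed.

Lemma measurable_diagonal_snd :
  measurable_fun setT (fun x : R * R => cdf2 P x.2 x.2).
Proof. exact: (measurableT_comp measurable_diagonal measurable_snd). Qed.

Lemma measurable_concordance_minorant : measurable_fun setT concordance_minorant.
Proof.
apply: measurable_funD; last exact: measurable_diagonal_snd.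
by apply: measurable_funB => //; exact: measurable_minimum.
Qed.

Lemma unit_squareP (x : R * R) : D x -> 0 <= x.1 <= 1 /\ 0 <= x.2 <= 1.
Proof. by case; rewrite /= !in_itv/=. Qed.

Lemma normr_minimum (x : R * R) : D x -> `|Num.min x.1 x.2| <= 1.
Proof.
move=> /unit_squareP[x1 x2]; rewrite ger0_norm ?le_min ?ge_min; last lra.
by apply/orP; left; lra.
Qed.

Lemma normr_snd (x : R * R) : D x -> `|x.2| <= 1.
Proof. by move=> /unit_squareP[_ x2]; rewrite ler_norml; lra. Qed.

Lemma normr_minorant (x : R * R) : D x -> `|concordance_minorant x| <= 3.
Proof.
move=> Dx; apply: le_trans (ler_normD _ _) _.
rewrite (_ : 3 = 2 + 1) ?lerD ?normr_cdf2//; last by field.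
apply: le_trans (ler_normB _ _) _.
by rewrite (_ : 2 = 1 + 1) ?lerD ?normr_minimum ?normr_snd.
Qed.

Lemma integral_minorant :
  \int[P]_(x in D) concordance_minorant x = 2 * diagonal_integral - 1 / 2.
Proof.
have mD := @measurable_unit_square R.
have imin := integrable_unit_square measurable_minimum normr_minimum.
have isnd := integrable_unit_square (@measurable_snd _ _ R R) normr_snd.
rewrite RintegralD//; last 2 first.
- apply: (@integrable_unit_square _ 2).
  + by apply: measurable_funB => //; exact: measurable_minimum.
  + move=> x Dx; apply: le_trans (ler_normB _ _) _.
    by rewrite (_ : 2 = 1 + 1) ?lerD ?normr_minimum ?normr_snd.
- apply: (@integrable_unit_square _ 1); first exact: measurable_diagonal_snd.
  by move=> x _; exact: normr_cdf2.
rewrite RintegralB// integral_min.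
rewrite (integral_marginal2 PU (g := fun v => cdf2 P v v)); last 2 first.
- exact: measurable_diagonal.
- by move=> x _; exact: cdf2_ge0.
rewrite (integral_marginal2 PU (g := fun v => v))//; last first.
  by move=> x /andP[].
(* The term [- x.2] contributes minus the mean of a uniform variable, hence [- 1 / 2]. *)
rewrite (@integral_eq_affine _ id 1 (@measurable_id _ R setT) _ 0 1 1 0)//; last 2 first.
- by move=> x x01; rewrite ler_norml; lra.
- by move=> x _; lra.
rewrite /diagonal_integral; lra.
Qed.

Lemma integrable_cdf2 : P.-integrable D (EFin \o (fun x => cdf2 P x.1 x.2)).
Proof.
apply: (@integrable_unit_square _ 1); first exact: measurable_cdf2.
by move=> x _; exact: normr_cdf2.
Qed.

Lemma concordance_integral_le : concordance_integral <= diagonal_integral.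
Proof.
rewrite -integral_min; apply: le_Rintegral.
- exact: measurable_unit_square.
- exact: integrable_cdf2.
- exact: integrable_unit_square measurable_minimum normr_minimum.
- by move=> x /unit_squareP[? ?]; exact: cdf2_le_min.
Qed.

Lemma concordance_integral_ge :
  2 * diagonal_integral - 1 / 2 <= concordance_integral.
Proof.
rewrite -integral_minorant; apply: le_Rintegral.
- exact: measurable_unit_square.
- exact: integrable_unit_square measurable_concordance_minorant normr_minorant.
- exact: integrable_cdf2.
- by move=> x /unit_squareP[? ?]; exact: cdf2_ge_diagonal.
Qed.

Lemma measurable_unit_square_neq (f g : R * R -> R) :
  measurable_fun setT f -> measurable_fun setT g ->
  measurable [set x | D x /\ f x != g x].
Proof.
move=> mf mg; rewrite -[X in measurable X]/(D `&` _).
apply: measurableI; first exact: measurable_unit_square.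
rewrite [X in measurable X](_ : _ = ~` [set x | f x == g x]).
  apply: measurableC; rewrite -[X in measurable X]setTI.
  exact: (measurable_fun_eqr mf mg measurableT (Y := [set true]) I).
by apply/seteqP; split => x /= /negP.
Qed.

(** Serves the equality cases: for an extremal copula the distribution function agrees almost
    everywhere with the minimum or with [concordance_minorant], whose integrals are known. *)
Lemma concordance_integral_ae (g : R * R -> R) : measurable_fun setT g ->
  P [set x | D x /\ cdf2 P x.1 x.2 != g x] = 0%E ->
  concordance_integral = \int[P]_(x in D) g x.
Proof.
move=> mg N0; have mD := @measurable_unit_square R.
have mc := measurable_cdf2 P.
rewrite /concordance_integral /Rintegral; congr fine.
apply: ae_eq_integral => //.
- by apply/measurable_EFinP; exact: measurable_funTS.
- by apply/measurable_EFinP; exact: measurable_funTS.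
exists [set x | D x /\ cdf2 P x.1 x.2 != g x]; split => //.
  exact: measurable_unit_square_neq.
by move=> x /= /not_implyP[Dx /eqP].
Qed.

End concordance_bounds.

(** * Bounds on Spearman's footrule *)

Section footrule_bounds.
Variable R : realType.
Notation leb := (@lebesgue_measure R).
Variable P : probability (R * R)%type R.
Hypothesis PU : uniform_marginals P.
Let d := cdf2 P 2^-1 2^-1.

Let half01 : 0 <= (2^-1 : R) <= 1.
Proof. lra. Qed.

Lemma cdf2_half_bounds : 0 <= d <= 2^-1.
Proof.
rewrite cdf2_ge0 /=; apply: le_trans (cdf2_le_min PU half01 half01) _.
by rewrite ge_min lexx.
Qed.

(** The coordinates are moved one at a time, each at a cost of at most [v - u]. *)
Lemma diagonal_lip (u v : R) : 0 <= u -> u <= v -> v <= 1 ->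
  0 <= cdf2 P v v - cdf2 P u u <= 2 * (v - u).
Proof.
move=> u0 uv v1.
have u01 : 0 <= u <= 1 by lra.
have v01 : 0 <= v <= 1 by lra.
have := cdf2_lip PU u0 uv v1 v01; have := cdf2_lip2 PU u0 uv v1 u01; lra.
Qed.

Let fM (x : R) : 0 <= x <= 1 -> `|cdf2 P x x| <= 1.
Proof. by move=> _; exact: normr_cdf2. Qed.

Let mdiag := measurable_diagonal P.

(** The diagonal lies below the identity, below [d] left of 1/2, and below the line of slope 2
    through [(1/2, d)] right of it; these bounds cross at [d] and [1 - d]. The right side is
    [footrule_upper] at [4 * d - 1], rescaled. *)
Lemma diagonal_integral_le :
  diagonal_integral P <= (1 - 3 / 8 * (1 - (4 * d - 1)) ^+ 2 + 2) / 6.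
Proof.
have /andP[d0 d2] := cdf2_half_bounds.
rewrite /diagonal_integral.
rewrite (@integral_split _ _ 1 mdiag fM 0 2^-1 1); try lra.
rewrite (@integral_split _ _ 1 mdiag fM 0 d 2^-1); try lra.
rewrite (@integral_split _ _ 1 mdiag fM 2^-1 (1 - d) 1); try lra.
have I1 := @integral_le_affine _ _ 1 mdiag fM 0 d 1 0.
have I2 := @integral_le_affine _ _ 1 mdiag fM d 2^-1 0 d.
have I3 := @integral_le_affine _ _ 1 mdiag fM 2^-1 (1 - d) 2 (d - 1).
have I4 := @integral_le_affine _ _ 1 mdiag fM (1 - d) 1 1 0.
have le_id (x : R) : 0 <= x <= 1 -> cdf2 P x x <= 1 * x + 0.
  by move=> x01; have := cdf2_le_min PU x01 x01; rewrite minxx; lra.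
apply: le_trans.
  apply: lerD; [apply: lerD; [apply: I1|apply: I2]|apply: lerD; [apply: I3|apply: I4]].
  all: try lra.
  - by move=> x Hx; apply: le_id; lra.
  - move=> x Hx; have := @diagonal_lip x 2^-1; rewrite -/d; lra.
  - move=> x Hx; have := @diagonal_lip 2^-1 x; rewrite -/d; lra.
  - by move=> x Hx; apply: le_id; lra.
Qed.

(** The dual minorant: 0, then slope 2 up to [(1/2, d)], then constant [d], then slope 2 up to
    [(1, 1)], with breaks at [(1 - d) / 2] and [(1 + d) / 2]. *)
Lemma diagonal_integral_ge :
  (3 / 16 * (1 + (4 * d - 1)) ^+ 2 - 1 / 2 + 2) / 6 <= diagonal_integral P.
Proof.
have /andP[d0 d2] := cdf2_half_bounds.
rewrite /diagonal_integral.
rewrite (@integral_split _ _ 1 mdiag fM 0 2^-1 1); try lra.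
rewrite (@integral_split _ _ 1 mdiag fM 0 ((1 - d) / 2) 2^-1); try lra.
rewrite (@integral_split _ _ 1 mdiag fM 2^-1 ((1 + d) / 2) 1); try lra.
have I1 := @integral_ge_affine _ _ 1 mdiag fM 0 ((1 - d) / 2) 0 0.
have I2 := @integral_ge_affine _ _ 1 mdiag fM ((1 - d) / 2) 2^-1 2 (d - 1).
have I3 := @integral_ge_affine _ _ 1 mdiag fM 2^-1 ((1 + d) / 2) 0 d.
have I4 := @integral_ge_affine _ _ 1 mdiag fM ((1 + d) / 2) 1 2 (-1).
apply: (@le_trans _ _ (_ + _ + (_ + _))); last first.
  apply: lerD; [apply: lerD; [apply: I1|apply: I2]|apply: lerD; [apply: I3|apply: I4]].
  all: try lra.
  - by move=> x _; have := cdf2_ge0 P x x; lra.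
  - move=> x Hx; have := @diagonal_lip x 2^-1; rewrite -/d; lra.
  - move=> x Hx; have := @diagonal_lip 2^-1 x; rewrite -/d; lra.
  - move=> x Hx; have := @diagonal_lip x 1; rewrite (PU.2 1 _).1; lra.
Qed.
End footrule_bounds.

(** * Passage between copulas and probabilities with uniform marginals *)

Section copula_functionals.
Variable R : realType.
Notation leb := (@lebesgue_measure R).
Local Notation D := (@unit_square R).

(** Agreement on measurable sets is assumed rather than equality, since this is all that
    [copula_of_marginals] provides. *)
Lemma copula_functionalsE (C : copula R) (P : probability (R * R)%type R) :
  (forall A, measurable A -> copula_measure C A = P A) ->
  [/\ uniform_marginals P,
      kendall_tau C = 4 * concordance_integral P - 1,
      spearman_footrule C = 6 * diagonal_integral P - 2 &
      blomqvist_beta C = 4 * cdf2 P 2^-1 2^-1 - 1].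
Proof.
move=> QP; have [Q1 QC] := copula_measureP C.
have CE (u v : R) : 0 <= u <= 1 -> 0 <= v <= 1 -> C u v = cdf2 P u v.
  by move=> u01 v01; rewrite /cdf2 -QP ?QC//; exact: measurable_box.
have half01 : 0 <= (2^-1 : R) <= 1 by lra.
split.
- split; first by rewrite -QP//; exact: measurable_unit_square.
  have h1 : 0 <= (1 : R) <= 1 by rewrite ler01 lexx.
  move=> u u01; rewrite -!CE//; split; first exact: copula_marginal1.
  exact: copula_marginal2.
- rewrite /kendall_tau /concordance_integral; congr (4 * _ - 1).
  transitivity (\int[copula_measure C]_(x in D) cdf2 P x.1 x.2).
    by apply: eq_Rintegral => x /set_mem/unit_squareP[? ?]; rewrite CE.
  by rewrite /Rintegral; congr fine; apply: eq_measure_integral => A mA _; exact: QP.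
- rewrite /spearman_footrule /diagonal_integral; congr (6 * _ - 2).
  by apply: eq_Rintegral => x /set_mem /=; rewrite in_itv/= => ?; rewrite CE.
- by rewrite /blomqvist_beta CE.
Qed.

(** [copula_measure] is a chosen witness, so [copula_measure_unique] is what identifies it with
    [P]. *)
Lemma copula_of_marginals (P : probability (R * R)%type R) :
  uniform_marginals P ->
  exists C : copula R, forall A, measurable A -> copula_measure C A = P A.
Proof.
move=> PU.
have df : distribution_function_of P (cdf2 P).
  by split; [exact: PU.1|move=> u v _ _; exact: cdf2E].
pose C := @Copula R (cdf2 P) (ex_intro _ P df)
  (fun u u01 => (PU.2 u u01).1) (fun u u01 => (PU.2 u u01).2).
by exists C; exact: (@copula_measure_unique _ C).
Qed.
End copula_functionals.

(** * Convex mixtures of probabilities and of copulas *)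

Section mixture.
Context d (T : measurableType d) (R : realType).
Variables (l : R) (l01 : 0 <= l <= 1) (P Q : probability T R).

Let l0 : 0 <= l. Proof. by case/andP: l01. Qed.
Let l1 : 0 <= 1 - l. Proof. by rewrite subr_ge0; case/andP: l01. Qed.

Definition mixture : set T -> \bar R :=
  measure_add (mscale (NngNum l0) P) (mscale (NngNum l1) Q).

HB.instance Definition _ := Measure.copy mixture
  (measure_add (mscale (NngNum l0) P) (mscale (NngNum l1) Q)).

Let mixtureT : mixture setT = 1%E.
Proof.
by rewrite [LHS]measure_addE /= /mscale /= !probability_setT !mule1 -EFinD addrC subrK.
Qed.

HB.instance Definition _ :=
  Measure_isProbability.Build _ _ _ mixture mixtureT.

Lemma mixtureE A :
  (mixture : probability T R) A = (l%:E * P A + (1 - l)%:E * Q A)%E.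
Proof. exact: measure_addE. Qed.

Lemma Rintegral_mixture (A : set T) (f : T -> R) (M : R) : measurable A ->
  measurable_fun setT f -> (forall x, A x -> 0 <= f x <= M) ->
  \int[mixture]_(x in A) f x =
  l * \int[P]_(x in A) f x + (1 - l) * \int[Q]_(x in A) f x.
Proof.
move=> mA mf fM.
have fin (m : probability T R) : (\int[m]_(x in A) (f x)%:E)%E \is a fin_num.
  apply: integrable_fin_num => //; apply: (@integrable_bounded _ _ _ _ _ _ M) => //.
  - by rewrite (le_lt_trans (probability_le1 _ _)) ?ltry.
  - exact: measurable_funTS.
  - by move=> x /fM /andP[f0 fle]; rewrite ger0_norm.
have mfA : measurable_fun A (EFin \o f).
  by apply/measurable_EFinP; exact: measurable_funTS.
have f0 x : A x -> (0 <= (f x)%:E)%E by move=> /fM /andP[]; rewrite lee_fin.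
rewrite {1}/Rintegral.
rewrite ge0_integral_measure_add// !ge0_integral_mscale//=.
by rewrite fineD ?fineM// fin_numM.
Qed.
End mixture.

Section mixture_copula.
Variable R : realType.
Local Notation D := (@unit_square R).
Variables (l : R) (l01 : 0 <= l <= 1) (P Q : probability (R * R)%type R).
Local Notation M := (mixture l01 P Q).

Lemma cdf2_mixture u v : cdf2 M u v = l * cdf2 P u v + (1 - l) * cdf2 Q u v.
Proof. by rewrite {1}/cdf2 mixtureE !cdf2E -!EFinM -EFinD. Qed.

Lemma uniform_marginals_mixture :
  uniform_marginals P -> uniform_marginals Q -> uniform_marginals M.
Proof.
move=> [P1 PU] [Q1 QU]; split.
  by rewrite mixtureE P1 Q1 !mule1 -EFinD addrC subrK.
move=> u u01; rewrite !cdf2_mixture.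
have [-> ->] := PU u u01; have [-> ->] := QU u u01; split; ring.
Qed.

(** The integral is bilinear in integrand and measure. The two cross terms are left unevaluated:
    what matters later is that the result is a polynomial in [l]. *)
Lemma concordance_integral_mixture : concordance_integral M =
  l * (l * concordance_integral P +
       (1 - l) * \int[P]_(x in D) cdf2 Q x.1 x.2) +
  (1 - l) * (l * (\int[Q]_(x in D) cdf2 P x.1 x.2) +
       (1 - l) * concordance_integral Q).
Proof.
have mD := @measurable_unit_square R.
have cint (m N : probability (R * R)%type R) :
    m.-integrable D (EFin \o (fun x : R * R => cdf2 N x.1 x.2)).
  apply: (@integrable_bounded _ _ _ _ _ _ 1) => //.
  - by rewrite (le_lt_trans (probability_le1 _ _)) ?ltry.
  - exact: measurable_funTS (measurable_cdf2 N).
  - by move=> x _; exact: normr_cdf2.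
have kint (m N : probability (R * R)%type R) (k : R) :
    m.-integrable D (EFin \o (fun x : R * R => k * cdf2 N x.1 x.2)).
  rewrite (_ : EFin \o _ = fun x => (k%:E * (cdf2 N x.1 x.2)%:E)%E)//.
  exact: (integrableZl mD k (cint m N)).
have split_int (m : probability (R * R)%type R) :
    \int[m]_(x in D) cdf2 M x.1 x.2 =
    l * \int[m]_(x in D) cdf2 P x.1 x.2 +
    (1 - l) * \int[m]_(x in D) cdf2 Q x.1 x.2.
  under eq_Rintegral do rewrite cdf2_mixture.
  rewrite RintegralD ?(RintegralZl _ mD (cint _ _))//; exact: kint.
rewrite {1}/concordance_integral (@Rintegral_mixture _ _ _ _ _ _ _ _ _ 1)//.
- by rewrite !split_int.
- exact: measurable_cdf2.
- by move=> x _; rewrite cdf2_ge0 cdf2_le1.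
Qed.

End mixture_copula.

(** * The diagonal copula of a given diagonal section *)

Section right_inverse.
Variables (R : realType) (F : R -> R).
Hypotheses (F0 : F 0 = 0) (F1 : F 1 = 1).
Hypothesis Flip : forall u v, 0 <= u -> u <= v -> v <= 1 ->
  0 <= F v - F u <= 2 * (v - u).

(** [F] is controlled on [[0, 1]] only; composing with this 1-Lipschitz projection yields functions
    well behaved on the whole line. *)
Let clamp (x : R) := Num.max 0 (Num.min x 1).

Let clamp01 x : 0 <= clamp x <= 1.
Proof. by rewrite /clamp le_max lexx ge_max ler01 ge_min lexx orbT. Qed.

Let clamp_id x : 0 <= x <= 1 -> clamp x = x.
Proof.
by move=> /andP[x0 x1]; rewrite /clamp (min_idPl x1) (max_idPr x0).
Qed.

Let clamp_le x y : x <= y -> 0 <= clamp y - clamp x <= y - x.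
Proof.
move=> xy; rewrite /clamp.
have [x1|x1] := leP x 1; have [y1|y1] := leP y 1; try lra.
- by have [x0|x0] := leP 0 x; have [y0|y0] := leP 0 y; lra.
- by rewrite (max_idPr (@ler01 R)); have [x0|x0] := leP 0 x; lra.
Qed.

(** The intermediate value theorem gives preimages, and any choice of them is nondecreasing because
    [F] is. Monotonicity is what makes [q] measurable. *)
Lemma nondecreasing_right_inverse : exists q : R -> R,
  nondecreasing_fun q /\
  forall s, 0 <= s <= 1 -> 0 <= q s <= 1 /\ F (q s) = s.
Proof.
have Fcont : continuous (F \o clamp).
  move=> x; apply/cvgrPdist_le => e e0; near=> y.
  have xy : `|x - y| <= e / 2.
    by near: y; apply: cvgr_dist_le => //; rewrite divr_gt0.
  move: xy; rewrite /= !ler_norml.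
  have /andP[x0 x1] := clamp01 x; have /andP[y0 y1] := clamp01 y.
  have [lexy|/ltW leyx] := leP x y.
    have /andP[c0 c1] := clamp_le lexy.
    have := @Flip (clamp x) (clamp y); lra.
  have /andP[c0 c1] := clamp_le leyx.
  have := @Flip (clamp y) (clamp x); lra.
have ex (s : R) : exists x, 0 <= x <= 1 /\ F x = clamp s.
  have [|||x] := @IVT _ (F \o clamp) 0 1 (clamp s).
  - exact: ler01.
  - exact: continuous_subspaceT.
  - have /andP[s0 s1] := clamp01 s.
    rewrite /= (clamp_id (x := 0)) ?lexx ?ler01// (clamp_id (x := 1)) ?lexx ?ler01//.
    rewrite F0 F1 ge_min s0 /=.
    by rewrite le_max s1 orbT.
  - by rewrite in_itv/= => x01 <-; exists x; rewrite clamp_id.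
have [q0 Hq0] := choice ex.
exists (q0 \o clamp); split; last first.
  by move=> s s01; rewrite /= clamp_id//; have := Hq0 s; rewrite clamp_id.
(* A strict decrease of [q] would force the clamped values of [s] and [t] to coincide by
   monotonicity of [F], and then so would the values of [q]. *)
move=> s t st; rewrite /= leNgt; apply/negP => lt_q.
have [/andP[qs0 qs1] Fs] := Hq0 (clamp s).
have [/andP[qt0 qt1] Ft] := Hq0 (clamp t).
have := Flip qt0 (ltW lt_q) qs1.
rewrite Fs Ft (clamp_id (clamp01 s)) (clamp_id (clamp01 t)).
have := clamp_le st => cst c1.
have E : clamp s = clamp t by lra.
by move: lt_q; rewrite E ltxx.
Unshelve. all: by end_near. Qed.
End right_inverse.

Section upper_copula.
Variable R : realType.
Notation leb := (@lebesgue_measure R).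
Local Notation D := (@unit_square R).

(** [A] lies between [[0, m[] and [[0, m]] within the unit interval. The point [m] is left open:
    where [F] is flat, a right inverse may choose either side. *)
Lemma unif_squeeze (A : set R) (m : R) : measurable A -> 0 <= m <= 1 ->
  (forall s, 0 <= s <= 1 -> s < m -> A s) ->
  (forall s, 0 <= s <= 1 -> A s -> s <= m) -> unif R A = m%:E.
Proof.
move=> mA /andP[m0 m1] sub sup; rewrite unifE//.
apply/eqP; rewrite eq_le; apply/andP; split.
  rewrite -[leRHS](_ : leb `[0, m]%classic = _); last by rewrite leb_itv01 ?subr0.
  apply: le_measure; rewrite ?inE//; first exact: measurableI.
  by move=> s [As]; rewrite /= !in_itv/= => s01; have := sup s s01 As; lra.
rewrite -[leLHS](_ : leb `[0, m[%classic = _); last by rewrite leb_itv01 ?subr0.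
apply: le_measure; rewrite ?inE//; first exact: measurableI.
move=> s /=; rewrite in_itv/= => /andP[s0 sm].
have s01 : 0 <= s <= 1 by lra.
by split; [exact: sub|rewrite /= in_itv/=].
Qed.

Lemma law_unif_neq (h k : R -> R) (mh : measurable_fun setT h)
    (mk : measurable_fun setT k) (F G : R * R -> R) :
  measurable_fun setT F -> measurable_fun setT G ->
  (forall s, 0 <= s <= 1 -> F (h s, k s) = G (h s, k s)) ->
  law (unif R) (measurable_fun_pair mh mk) [set x | D x /\ F x != G x] = 0%E.
Proof.
move=> mF mG FG; rewrite [LHS]unifE; last first.
  rewrite -[X in measurable X]setTI.
  apply: (measurable_fun_pair mh mk measurableT).
  exact: measurable_unit_square_neq.
rewrite -[RHS](measure0 leb); congr (leb _).
apply/seteqP; split => // s [[_ /= /eqP ne]]; rewrite in_itv/= => s01.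
by case: ne; exact: FG.
Qed.

Variable P : probability (R * R)%type R.
Hypothesis PU : uniform_marginals P.
Let delta (u : R) := cdf2 P u u.
(** Chosen so that [phi u + delta u = 2 * u], which makes the symmetrized law have uniform
    marginals. *)
Let phi (u : R) := 2 * u - delta u.

Let delta0 : delta 0 = 0.
Proof. by rewrite /delta cdf2_0l// lexx ler01. Qed.

Let delta1 : delta 1 = 1.
Proof. by have [|] := PU.2 1; rewrite ?lexx ?ler01. Qed.

Let phi_lip u v : 0 <= u -> u <= v -> v <= 1 ->
  0 <= phi v - phi u <= 2 * (v - u).
Proof.
by move=> u0 uv v1; have := diagonal_lip PU u0 uv v1; rewrite /phi /delta; lra.
Qed.

Section law_of_inverses.
Variables (F G q r : R -> R).
Hypotheses (F0 : F 0 = 0) (F1 : F 1 = 1) (G0 : G 0 = 0) (G1 : G 1 = 1).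
Hypothesis Flip : forall u v, 0 <= u -> u <= v -> v <= 1 ->
  0 <= F v - F u <= 2 * (v - u).
Hypothesis Glip : forall u v, 0 <= u -> u <= v -> v <= 1 ->
  0 <= G v - G u <= 2 * (v - u).
Hypotheses (mq : measurable_fun setT q) (mr : measurable_fun setT r).
Hypothesis qP : forall s, 0 <= s <= 1 -> 0 <= q s <= 1 /\ F (q s) = s.
Hypothesis rP : forall s, 0 <= s <= 1 -> 0 <= r s <= 1 /\ G (r s) = s.

(** Except at the boundary values, [q s <= u] amounts to [s <= F u] and [r s <= v] to [s <= G v]. *)
Lemma cdf2_law_inverses (u v : R) : 0 <= u <= 1 -> 0 <= v <= 1 ->
  cdf2 (law (unif R) (measurable_fun_pair mq mr)) u v = Num.min (F u) (G v).
Proof.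
move=> /andP[u0 u1] /andP[v0 v1].
have /andP[Fu0 _] := Flip (lexx 0) u0 u1; have /andP[Fu1 _] := Flip u0 u1 (lexx 1).
have /andP[Gv0 _] := Glip (lexx 0) v0 v1; have /andP[Gv1 _] := Glip v0 v1 (lexx 1).
rewrite F0 subr0 in Fu0; rewrite G0 subr0 in Gv0.
rewrite F1 subr_ge0 in Fu1; rewrite G1 subr_ge0 in Gv1.
rewrite /cdf2 [X in fine X](@unif_squeeze _ (Num.min (F u) (G v)))//.
- rewrite -[X in measurable X]setTI.
  by apply: (measurable_fun_pair mq mr) => //; exact: measurable_box.
- by rewrite le_min Fu0 Gv0 ge_min Fu1.
- move=> s s01; rewrite lt_min => /andP[sF sG].
  have [/andP[q0 q1] Fq] := qP s01; have [/andP[r0 r1] Gr] := rP s01.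
  split; rewrite /= in_itv/= ?q0 ?r0 /= leNgt; apply/negP => lt.
    by have := Flip u0 (ltW lt) q1; lra.
  by have := Glip v0 (ltW lt) r1; lra.
- move=> s s01 [/=]; rewrite !in_itv/= => /andP[_ qu] /andP[_ rv].
  have [/andP[q0 q1] Fq] := qP s01; have [/andP[r0 r1] Gr] := rP s01.
  rewrite le_min; apply/andP; split.
    by have := Flip q0 qu u1; lra.
  by have := Glip r0 rv v1; lra.
Qed.
End law_of_inverses.

Lemma upper_copula_exists : exists Q : probability (R * R)%type R,
  [/\ uniform_marginals Q,
      forall u, 0 <= u <= 1 -> cdf2 Q u u = cdf2 P u u &
      concordance_integral Q = diagonal_integral Q].
Proof.
have phi0 : phi 0 = 0 by rewrite /phi delta0; lra.
have phi1 : phi 1 = 1 by rewrite /phi delta1; lra.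
have dlip := diagonal_lip PU.
have [q [q_nd qP]] := nondecreasing_right_inverse phi0 phi1 phi_lip.
have [r [r_nd rP]] := nondecreasing_right_inverse delta0 delta1 dlip.
have mq : measurable_fun setT q by exact: nondecreasing_measurable.
have mr : measurable_fun setT r by exact: nondecreasing_measurable.
pose L := law (unif R) (measurable_fun_pair mq mr).
have LE u v : 0 <= u <= 1 -> 0 <= v <= 1 -> cdf2 L u v = Num.min (phi u) (delta v).
  exact: cdf2_law_inverses.
have half01 : 0 <= (2^-1 : R) <= 1 by lra.
pose Q := mixture half01 L (swap_law L) : probability (R * R)%type R.
have QE u v : 0 <= u <= 1 -> 0 <= v <= 1 -> cdf2 Q u v =
    2^-1 * Num.min (phi u) (delta v) + 2^-1 * Num.min (phi v) (delta u).
  move=> u01 v01; rewrite cdf2_mixture cdf2_swap !LE//; lra.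
have i01 : 0 <= (1 : R) <= 1 by rewrite ler01 lexx.
have delta_le u : 0 <= u <= 1 -> delta u <= u.
  by move=> u01; have := cdf2_le_min PU u01 u01; rewrite minxx.
have delta_ge u : 0 <= u <= 1 -> phi u <= 1.
  by move=> /andP[u0 u1]; have := phi_lip u0 u1 (lexx 1); lra.
have QU : uniform_marginals Q.
  split; first by rewrite [LHS]cdf2E QE// phi1 delta1 minxx; congr (_%:E); lra.
  move=> u u01; rewrite !QE// phi1 delta1.
  have := delta_le u u01; have := delta_ge u u01; have [u0 u1] := andP u01.
  move=> p1 du; rewrite (min_idPl p1) (min_idPr (le_trans du u1)).
  by rewrite /phi; split; lra.
exists Q; split => //.
- move=> u u01; rewrite QE// -/(delta u).
  (* From [delta u <= u] follows [delta u <= phi u], so both minima equal [delta u]. *)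
  have du := delta_le u u01; rewrite min_r; last by rewrite /phi; lra.
  by lra.
rewrite -(integral_min QU); apply: concordance_integral_ae.
  exact: measurable_minimum.
have mQ := measurable_cdf2 Q; have mmin := @measurable_minimum R.
(* On the curve [phi (q s) = delta (r s) = s], so the first minimum is [s]; the second is
   [2 * min(q s, r s) - s]. Their mean attains the Frechet-Hoeffding bound. *)
have on_curve s : 0 <= s <= 1 -> cdf2 Q (q s) (r s) = Num.min (q s) (r s).
  move=> s01; have [q01 qs] := qP s s01; have [r01 rs] := rP s s01.
  rewrite QE// qs rs minxx.
  have -> : phi (r s) = 2 * r s - s by rewrite /phi rs.
  have -> : delta (q s) = 2 * q s - s by move: qs; rewrite /phi; lra.
  by have [] := leP (q s) (r s) => ?; have [] := leP (2 * r s - s) (2 * q s - s) => ?; lra.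
have sym u v : cdf2 Q u v = cdf2 Q v u.
  by rewrite !cdf2_mixture !cdf2_swap; lra.
rewrite mixtureE [X in (_ * X + _)%E]law_unif_neq//.
rewrite [X in (_ + _ * X)%E]law_unif_neq ?mule0 ?adde0//.
by move=> s s01; rewrite /= sym on_curve// minC.
Qed.
End upper_copula.

(** * The nested reflection *)

Section nested_reflection.
Variable F : realFieldType.

(* The support is the main diagonal outside [e, 1 - e], the antidiagonal
   between [e, 1 - e] and [1/2 - g, 1/2 + g], and the two antidiagonals of
   [1/2 - g, 1/2]^2 and [1/2, 1/2 + g]^2. *)
Definition nested_reflection (e g x : F) : F :=
  if x < e then x else if 1 - e < x then x else
  if x < 2^-1 - g then 1 - x else if 2^-1 + g < x then 1 - x else
  if x <= 2^-1 then 1 - g - x else 1 + g - x.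

(** A disjunction of linear conditions, so that every branch can be handed to [lra]. *)
Lemma nested_reflectionP (e g s : F) :
  (s < e /\ nested_reflection e g s = s) \/
  (e <= s /\ 1 - e < s /\ nested_reflection e g s = s) \/
  (e <= s <= 1 - e /\ s < 2^-1 - g /\ nested_reflection e g s = 1 - s) \/
  (e <= s <= 1 - e /\ 2^-1 + g < s /\ nested_reflection e g s = 1 - s) \/
  (e <= s <= 1 - e /\ 2^-1 - g <= s <= 2^-1 /\
     nested_reflection e g s = 1 - g - s) \/
  (e <= s <= 1 - e /\ 2^-1 < s <= 2^-1 + g /\
     nested_reflection e g s = 1 + g - s).
Proof.
rewrite /nested_reflection; case: (ltP s e) => i1; first by left.
case: (ltP (1 - e) s) => i2; first by right; left.
case: (ltP s (2^-1 - g)) => i3; first by do 2 right; left.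
case: (ltP (2^-1 + g) s) => i4; first by do 3 right; left.
case: (leP s 2^-1) => i5; first by do 4 right; left.
by do 5 right.
Qed.

Ltac reflection_cases e g s :=
  have [[? Ef]|[[? [? Ef]]|[[? [? Ef]]|[[? [? Ef]]|[[? [? Ef]]|
    [? [? Ef]]]]]]] := nested_reflectionP e g s.

Lemma nested_reflection01 (e g : F) (e0 : 0 <= e) (g0 : 0 <= g)
  (eg : e + g <= 2^-1) (x : F) :
  0 <= x <= 1 -> 0 <= nested_reflection e g x <= 1.
Proof. by move=> x01; reflection_cases e g x; rewrite Ef {Ef}; lra. Qed.

(** Up to endpoints, the part of [[0, 1]] where [s <= u] and the reflection is at most [v] is
    [[0, b1]], [[a2, b2]] and [[a3, b3]], possibly degenerate. Nothing is asked at the endpoints,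
    where the reflection may jump. *)
Definition sublevel_intervals (e g u v b1 a2 b2 a3 b3 : F) : Prop :=
  [/\ [/\ 0 <= b1, b1 <= a2 & a2 <= b2], [/\ b2 <= a3, a3 <= b3 & b3 <= 1],
     forall s : F, 0 <= s <= 1 -> [|| s < b1, a2 < s < b2 | a3 < s < b3] ->
       s <= u /\ nested_reflection e g s <= v &
     forall s : F, 0 <= s <= 1 -> [|| b1 < s < a2, b2 < s < a3 | b3 < s] ->
       u < s \/ v < nested_reflection e g s].

(** In the left half only the corner below [e] and the left inner block stay in the left half; the
    rest is reflected across 1/2. *)
Lemma sublevel_half (e g : F) (e0 : 0 <= e) (g0 : 0 <= g)
  (eg : e + g <= 2^-1) :
  sublevel_intervals e g 2^-1 2^-1 e (2^-1 - g) 2^-1 2^-1 2^-1.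
Proof.
split; first by split; lra.
- by split; lra.
- by move=> s s01 /or3P[] Hs; reflection_cases e g s; rewrite Ef {Ef}; lra.
- move=> s s01 /or3P[] Hs; [right|lra|left; lra].
  by reflection_cases e g s; rewrite Ef {Ef}; lra.
Qed.

Lemma sublevel_fst (e g : F) (e0 : 0 <= e) (g0 : 0 <= g)
  (eg : e + g <= 2^-1) (u : F) : 0 <= u <= 1 ->
  sublevel_intervals e g u 1 u u u u u.
Proof.
move=> /andP[u0 u1]; split; first by split; lra.
- by split; lra.
- move=> s s01 Hs; have /andP[_ fs1] := nested_reflection01 e0 g0 eg s01.
  by case/or3P: Hs => Hs; split; lra.
- by move=> s s01 /or3P[] Hs; left; lra.
Qed.

Lemma sublevel_snd_lower_corner (e g : F) (e0 : 0 <= e) (g0 : 0 <= g)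
  (eg : e + g <= 2^-1) (v : F) :
  0 <= v <= 1 -> v < e ->
  sublevel_intervals e g 1 v v v v v v.
Proof.
move=> /andP[v0 v1] ve; split; [by split; lra|by split; lra| |].
- by move=> s /andP[s0 s1] /or3P[] Hs; reflection_cases e g s; rewrite Ef {Ef}; lra.
- move=> s /andP[s0 s1] /or3P[] Hs; right;
    by reflection_cases e g s; rewrite Ef {Ef}; lra.
Qed.

Lemma sublevel_snd_upper_corner (e g : F) (e0 : 0 <= e) (g0 : 0 <= g)
  (eg : e + g <= 2^-1) (v : F) :
  0 <= v <= 1 -> 1 - e < v ->
  sublevel_intervals e g 1 v v v v v v.
Proof.
move=> /andP[v0 v1] ev; split; [by split; lra|by split; lra| |].
- by move=> s /andP[s0 s1] /or3P[] Hs; reflection_cases e g s; rewrite Ef {Ef}; lra.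
- move=> s /andP[s0 s1] /or3P[] Hs; right;
    by reflection_cases e g s; rewrite Ef {Ef}; lra.
Qed.

Lemma sublevel_snd_lower_outer (e g : F) (e0 : 0 <= e) (g0 : 0 <= g)
  (eg : e + g <= 2^-1) (v : F) :
  0 <= v <= 1 -> e <= v < 2^-1 - g ->
  sublevel_intervals e g 1 v e (1 - v) (1 - e) (1 - e) (1 - e).
Proof.
move=> /andP[v0 v1] /andP[ev vg]; split; [by split; lra|by split; lra| |].
- by move=> s /andP[s0 s1] /or3P[] Hs; reflection_cases e g s; rewrite Ef {Ef}; lra.
- move=> s /andP[s0 s1] /or3P[] Hs; right;
    by reflection_cases e g s; rewrite Ef {Ef}; lra.
Qed.

Lemma sublevel_snd_upper_outer (e g : F) (e0 : 0 <= e) (g0 : 0 <= g)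
  (eg : e + g <= 2^-1) (v : F) :
  0 <= v <= 1 -> 2^-1 + g < v <= 1 - e ->
  sublevel_intervals e g 1 v e (1 - v) (1 - e) (1 - e) (1 - e).
Proof.
move=> /andP[v0 v1] /andP[gv ve]; split; [by split; lra|by split; lra| |].
- by move=> s /andP[s0 s1] /or3P[] Hs; reflection_cases e g s; rewrite Ef {Ef}; lra.
- move=> s /andP[s0 s1] /or3P[] Hs; right;
    by reflection_cases e g s; rewrite Ef {Ef}; lra.
Qed.

(** Three genuine pieces can occur: the lower corner, the end of the left block, and the right outer
    arm, whose image lies below [1/2 - g]. *)
Lemma sublevel_snd_lower_block (e g : F) (e0 : 0 <= e) (g0 : 0 <= g)
  (eg : e + g <= 2^-1) (v : F) :
  0 <= v <= 1 -> 2^-1 - g <= v < 2^-1 ->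
  sublevel_intervals e g 1 v e (1 - g - v) 2^-1 (2^-1 + g) (1 - e).
Proof.
move=> /andP[v0 v1] /andP[gv v2]; split; [by split; lra|by split; lra| |].
- by move=> s /andP[s0 s1] /or3P[] Hs; reflection_cases e g s; rewrite Ef {Ef}; lra.
- move=> s /andP[s0 s1] /or3P[] Hs; right;
    by reflection_cases e g s; rewrite Ef {Ef}; lra.
Qed.

Lemma sublevel_snd_upper_block (e g : F) (e0 : 0 <= e) (g0 : 0 <= g)
  (eg : e + g <= 2^-1) (v : F) :
  0 <= v <= 1 -> 2^-1 <= v <= 2^-1 + g ->
  sublevel_intervals e g 1 v e (2^-1 - g) 2^-1 (1 + g - v) (1 - e).
Proof.
move=> /andP[v0 v1] /andP[v2 vg]; split; [by split; lra|by split; lra| |].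
- by move=> s /andP[s0 s1] /or3P[] Hs; reflection_cases e g s; rewrite Ef {Ef}; lra.
- move=> s /andP[s0 s1] /or3P[] Hs; right;
    by reflection_cases e g s; rewrite Ef {Ef}; lra.
Qed.

(** For every position of [v] the lengths add up to [v]: the reflection preserves Lebesgue measure,
    whence the uniform second marginal. *)
Lemma sublevel_snd (e g : F) (e0 : 0 <= e) (g0 : 0 <= g)
  (eg : e + g <= 2^-1) (v : F) : 0 <= v <= 1 ->
  exists b1 a2 b2 a3 b3 : F, sublevel_intervals e g 1 v b1 a2 b2 a3 b3 /\
    b1 + (b2 - a2) + (b3 - a3) = v.
Proof.
move=> v01; have [ve|ev] := ltP v e.
  by exists v, v, v, v, v; split; [exact: sublevel_snd_lower_corner|ring].
have [ev'|ve'] := ltP (1 - e) v.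
  by exists v, v, v, v, v; split; [exact: sublevel_snd_upper_corner|ring].
have [vg|gv] := ltP v (2^-1 - g).
  exists e, (1 - v), (1 - e), (1 - e), (1 - e); split; last ring.
  by apply: sublevel_snd_lower_outer => //; rewrite ev.
have [gv'|vg'] := ltP (2^-1 + g) v.
  exists e, (1 - v), (1 - e), (1 - e), (1 - e); split; last ring.
  by apply: sublevel_snd_upper_outer => //; rewrite gv'.
have [v2|v2] := ltP v 2^-1.
  exists e, (1 - g - v), 2^-1, (2^-1 + g), (1 - e); split; last ring.
  by apply: sublevel_snd_lower_block => //; rewrite gv.
exists e, (2^-1 - g), 2^-1, (1 + g - v), (1 - e); split; last by field.
by apply: sublevel_snd_upper_block => //; rewrite v2.
Qed.

(** With [v] the image of [s] and [v < s], there is no mass in []v, s[ x [0, v]]: enlarging the box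
    from [v] to [s] gains nothing. *)
Lemma nested_reflection_gt (e g : F) (e0 : 0 <= e) (g0 : 0 <= g)
  (eg : e + g <= 2^-1) (s y : F) :
  nested_reflection e g s < y < s ->
  nested_reflection e g s < nested_reflection e g y.
Proof.
reflection_cases e g s; rewrite Ef {Ef} => /andP[y1 y2]; first lra.
- lra.
- lra.
- by reflection_cases e g y; rewrite Ef {Ef}; lra.
- by reflection_cases e g y; rewrite Ef {Ef}; lra.
- by reflection_cases e g y; rewrite Ef {Ef}; lra.
Qed.

(** With [v] the image of [s] and [s < v], all mass over []s, v[] has height at most [v]: enlarging
    the box from [s] to [v] gains the full [v - s]. *)
Lemma nested_reflection_le (e g : F) (e0 : 0 <= e) (g0 : 0 <= g)
  (eg : e + g <= 2^-1) (s y : F) :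
  s < y < nested_reflection e g s ->
  nested_reflection e g y <= nested_reflection e g s.
Proof.
reflection_cases e g s; rewrite Ef {Ef} => /andP[y1 y2]; first lra.
- lra.
- by reflection_cases e g y; rewrite Ef {Ef}; lra.
- lra.
- by reflection_cases e g y; rewrite Ef {Ef}; lra.
- by reflection_cases e g y; rewrite Ef {Ef}; lra.
Qed.

(** The breakpoints [1/2 - g / 2] and [1/2 + g / 2] are where the two inner antidiagonals cross the
    main diagonal. *)
Lemma min_nested_reflection (e g : F) (e0 : 0 <= e) (g0 : 0 <= g)
  (eg : e + g <= 2^-1) (s : F) :
  [/\ (0 < s < 2^-1 - g / 2) || (2^-1 < s < 2^-1 + g / 2) || (1 - e < s < 1) ->
       Num.min s (nested_reflection e g s) = s,
     2^-1 - g / 2 < s < 2^-1 -> Num.min s (nested_reflection e g s) = 1 - g - s,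
     2^-1 + g / 2 < s < 2^-1 + g ->
       Num.min s (nested_reflection e g s) = 1 + g - s &
     2^-1 + g < s < 1 - e -> Num.min s (nested_reflection e g s) = 1 - s].
Proof.
split.
- move=> H; apply: min_l; case/orP: H => [/orP[]|] Hs;
    by reflection_cases e g s; rewrite Ef {Ef}; lra.
- move=> Hs; have E : nested_reflection e g s = 1 - g - s.
    by reflection_cases e g s; rewrite Ef {Ef}; lra.
  by rewrite E; apply: min_r; lra.
- move=> Hs; have E : nested_reflection e g s = 1 + g - s.
    by reflection_cases e g s; rewrite Ef {Ef}; lra.
  by rewrite E; apply: min_r; lra.
- move=> Hs; have E : nested_reflection e g s = 1 - s.
    by reflection_cases e g s; rewrite Ef {Ef}; lra.
  by rewrite E; apply: min_r; lra.
Qed.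

End nested_reflection.

(** * The law carried by the graph of the nested reflection *)

Section lower_copula.
Variable R : realType.
Notation leb := (@lebesgue_measure R).
Local Notation D := (@unit_square R).

(** Squeeze: additivity on the disjoint open intervals from below, subadditivity on the closed ones,
    which may touch, from above. *)
Lemma unif_three_intervals (A : set R) (a1 b1 a2 b2 a3 b3 : R) :
  measurable A ->
  0 <= a1 -> a1 <= b1 -> b1 <= a2 -> a2 <= b2 -> b2 <= a3 -> a3 <= b3 -> b3 <= 1 ->
  (forall s, 0 <= s <= 1 ->
     [|| a1 < s < b1, a2 < s < b2 | a3 < s < b3] -> A s) ->
  (forall s, 0 <= s <= 1 -> A s ->
     [|| a1 <= s <= b1, a2 <= s <= b2 | a3 <= s <= b3]) ->
  unif R A = ((b1 - a1) + (b2 - a2) + (b3 - a3))%:E.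
Proof.
move=> mA a10 ab1 ba1 ab2 ba2 ab3 b31 sub sup; rewrite unifE// !EFinD -!EFinB.
apply/eqP; rewrite eq_le; apply/andP; split.
  apply: (@le_trans _ _ (leb (`[a1, b1]%classic `|` `[a2, b2]%classic
      `|` `[a3, b3]%classic))).
    apply: le_measure; rewrite ?inE; first exact: measurableI.
      by apply: measurableU => //; exact: measurableU.
    move=> s [As]; rewrite /= in_itv/= => s01.
    by have := sup s s01 As; rewrite !in_itv/= => /or3P[]; tauto.
  apply: le_trans (measureU2 _ _ _) _ => //; first exact: measurableU.
  apply: leeD; last by rewrite [leLHS]leb_itv01.
  apply: le_trans (measureU2 _ _ _) _ => //.
  by apply: leeD; rewrite [leLHS]leb_itv01.
apply: (@le_trans _ _ (leb (`]a1, b1[%classic `|` `]a2, b2[%classic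
    `|` `]a3, b3[%classic))).
  rewrite [leRHS]measureU//; last 2 first.
  - exact: measurableU.
  - by apply/seteqP; split => // s [/=]; rewrite !in_itv/=; lra.
  apply: leeD; last by rewrite [leRHS]leb_itv01.
  rewrite [leRHS]measureU//; last first.
    by apply/seteqP; split => // s [/=]; rewrite !in_itv/=; lra.
  by apply: leeD; rewrite [leRHS]leb_itv01.
apply: le_measure; rewrite ?inE.
- by apply: measurableU => //; exact: measurableU.
- exact: measurableI.
move=> s /=; rewrite !in_itv/= => H.
have s01 : 0 <= s <= 1 by case: H => [[]|]; lra.
split=> //; apply: sub => //.
by case: H => [[]|] ->; rewrite ?orbT.
Qed.

Lemma measurable_nested_reflection (e g : R) :
  measurable_fun setT (nested_reflection e g).
Proof.
by do ?[apply: measurable_fun_ifT => //; first by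
  [exact: measurable_fun_ltr | exact: measurable_fun_ler]]; exact: measurable_funB.
Qed.

Definition lower_law (e g : R) :=
  law (unif R) (measurable_fun_pair (@measurable_id _ R setT)
    (measurable_nested_reflection e g)).

Definition sublevel (e g u v : R) : set R :=
  [set y | 0 <= y <= u /\ 0 <= nested_reflection e g y <= v].

Lemma measurable_sublevel (e g u v : R) : measurable (sublevel e g u v).
Proof.
pose mXf := measurable_fun_pair (@measurable_id _ R setT)
  (measurable_nested_reflection e g).
have := mXf measurableT _ (measurable_box true false true false 0 u 0 v).
by rewrite setTI; congr (measurable _); apply/seteqP; split => y /=; rewrite !in_itv/=.
Qed.

Lemma unif_sublevel (e g u v : R) :
  unif R (sublevel e g u v) = (cdf2 (lower_law e g) u v)%:E.
Proof.
by rewrite -cdf2E; congr (unif R _).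
Qed.

Lemma cdf2_lower_intervals (e g : R) (e0 : 0 <= e) (g0 : 0 <= g)
  (eg : e + g <= 2^-1) (u v b1 a2 b2 a3 b3 : R) :
  sublevel_intervals e g u v b1 a2 b2 a3 b3 ->
  cdf2 (lower_law e g) u v = b1 + (b2 - a2) + (b3 - a3).
Proof.
move=> [[b10 ba1 ab2] [ba2 ab3 b31] sub sup].
have := unif_three_intervals (@measurable_sublevel e g u v)
  (lexx 0) b10 ba1 ab2 ba2 ab3 b31.
rewrite unif_sublevel subr0 => H; apply/EFin_inj/H => s s01.
  move=> Hs; have [|su fv] := sub s s01.
    by case/or3P: Hs => [/andP[_ ->]|->|->]; rewrite ?orbT.
  have /andP[s0 _] := s01; have /andP[fs0 _] := nested_reflection01 e0 g0 eg s01.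
  by split; apply/andP.
(* A point outside the three closed intervals lies in one of the open gaps, where [sup] excludes
   it. *)
move=> [/andP[s0 su] /andP[_ fv]]; rewrite s0 /=; apply: contrapT => nH.
suff : [|| b1 < s < a2, b2 < s < a3 | b3 < s].
  by move=> /(sup s s01) []; rewrite ltNge ?su ?fv.
have [sb1|sb1] := leP s b1; first by case: nH; rewrite sb1.
have [sa2|sa2] := ltP s a2; first by [].
have [sb2|sb2] := leP s b2; first by case: nH; rewrite sa2 sb2 orbT.
have [sa3|sa3] := ltP s a3; first by rewrite !orbT.
have [sb3|sb3] := leP s b3; first by case: nH; rewrite sa3 sb3 !orbT.
by rewrite !orbT.
Qed.

Lemma cdf2_lower_half (e g : R) (e0 : 0 <= e) (g0 : 0 <= g)
  (eg : e + g <= 2^-1) :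
  cdf2 (lower_law e g) 2^-1 2^-1 = e + g.
Proof.
by rewrite (cdf2_lower_intervals e0 g0 eg (sublevel_half e0 g0 eg)); ring.
Qed.

Lemma cdf2_lower_fst (e g : R) (e0 : 0 <= e) (g0 : 0 <= g)
  (eg : e + g <= 2^-1) (u : R) :
  0 <= u <= 1 -> cdf2 (lower_law e g) u 1 = u.
Proof.
move=> u01.
by rewrite (cdf2_lower_intervals e0 g0 eg (sublevel_fst e0 g0 eg u01)); ring.
Qed.

Lemma cdf2_lower_snd (e g : R) (e0 : 0 <= e) (g0 : 0 <= g)
  (eg : e + g <= 2^-1) (v : R) :
  0 <= v <= 1 -> cdf2 (lower_law e g) 1 v = v.
Proof.
move=> /(sublevel_snd e0 g0 eg)[b1 [a2 [b2 [a3 [b3 [H Hv]]]]]].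
by rewrite (cdf2_lower_intervals e0 g0 eg H).
Qed.

Lemma uniform_marginals_lower_law (e g : R) (e0 : 0 <= e) (g0 : 0 <= g)
    (eg : e + g <= 2^-1) :
  uniform_marginals (lower_law e g).
Proof.
have i01 : 0 <= (1 : R) <= 1 by rewrite ler01 lexx.
split; first by rewrite [LHS]cdf2E cdf2_lower_fst.
by move=> u u01; rewrite cdf2_lower_fst// cdf2_lower_snd.
Qed.
End lower_copula.

(** * Equality in the lower bound for tau, and the diagonal integral *)

Section lower_extremal.
Variable R : realType.
Notation leb := (@lebesgue_measure R).
Local Notation D := (@unit_square R).

(** One inequality is [cdf2_ge_diagonal]; the converse uses [nested_reflection_le] above the
    diagonal and [nested_reflection_gt] below it. *)
Lemma cdf2_lower_extremal (e g : R) (e0 : 0 <= e) (g0 : 0 <= g)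
    (eg : e + g <= 2^-1) (s : R) : 0 <= s <= 1 ->
  cdf2 (lower_law e g) s (nested_reflection e g s) =
  concordance_minorant (lower_law e g) (s, nested_reflection e g s).
Proof.
move=> s01; have v01 := nested_reflection01 e0 g0 eg s01.
have PU := uniform_marginals_lower_law e0 g0 eg.
have := cdf2_ge_diagonal PU s01 v01; rewrite /concordance_minorant /=.
set v := nested_reflection e g s in v01 *.
have [sv|vs] := leP s v; move=> le_s; apply/eqP; rewrite eq_le le_s andbT.
- have mI : measurable (`]s, v[%classic : set R) by exact: measurable_itv.
  have mA := measurable_sublevel e g s v.
  (* The sublevel set of [(s, v)] and the interval []s, v[] are disjoint and both lie in the
     sublevel set of [(v, v)]. *)
  suff : ((cdf2 (lower_law e g) s v)%:E + (v - s)%:E <=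
          (cdf2 (lower_law e g) v v)%:E)%E.
    by rewrite -EFinD lee_fin; lra.
  rewrite -!unif_sublevel.
  have <- : unif R `]s, v[%classic = (v - s)%:E.
    rewrite unifE// setIidl ?leb_itv01//.
    by move=> y /=; rewrite !in_itv/=; lra.
  rewrite -measureU//; last first.
    by apply/seteqP; split => // y [[/= y1 _]]; rewrite in_itv/=; lra.
  apply: le_measure; rewrite ?inE; [exact: measurableU|exact: measurable_sublevel|].
  move=> y [[/= y1 y2]|]; first by split => //; lra.
  rewrite /= in_itv/= => /andP[sy yv]; split; first by lra.
  have y01 : 0 <= y <= 1 by lra.
  have /andP[-> _] := nested_reflection01 e0 g0 eg y01.
  by apply: nested_reflection_le => //; rewrite sy.
(* The point [s] itself belongs to the sublevel set of [(s, v)] but may exceed [v]; it is absorbed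
   as a null set. *)
- suff : ((cdf2 (lower_law e g) s v)%:E <= (cdf2 (lower_law e g) v v)%:E)%E.
    by rewrite lee_fin; lra.
  rewrite -!unif_sublevel.
  have U0 : unif R [set s] = 0%E.
    rewrite unifE//; apply: (@subset_measure0 _ _ _ leb _ [set s]) => //.
      exact: measurableI.
    exact: lebesgue_measure_set1.
  rewrite -[leRHS]adde0 -[X in (_ <= _ + X)%E]U0.
  have mv := measurable_sublevel e g v v.
  apply: le_trans (measureU2 _ mv _) => //.
  apply: le_measure; rewrite ?inE; [exact: measurable_sublevel|exact: measurableU|].
  move=> y [/= /andP[y0 ys] y2].
  have [yv|vy] := leP y v; first by left; split => //; rewrite y0.
  right; apply/eqP; rewrite eq_le ys /= leNgt; apply/negP => lt_ys.
  have : nested_reflection e g s < nested_reflection e g y.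
    by apply: nested_reflection_gt => //; rewrite vy.
  by have /andP[_] := y2; rewrite leNgt => /negbTE ->.
Qed.

Lemma concordance_integral_lower (e g : R) (e0 : 0 <= e) (g0 : 0 <= g)
    (eg : e + g <= 2^-1) :
  concordance_integral (lower_law e g) =
  2 * diagonal_integral (lower_law e g) - 1 / 2.
Proof.
have PU := uniform_marginals_lower_law e0 g0 eg.
have mm := measurable_concordance_minorant (lower_law e g).
rewrite -integral_minorant//; apply: concordance_integral_ae => //.
apply: law_unif_neq => //; first exact: measurable_cdf2.
by move=> s s01; exact: cdf2_lower_extremal.
Qed.

Lemma integral_min_nested_reflection (e g : R) (e0 : 0 <= e) (g0 : 0 <= g)
    (eg : e + g <= 2^-1) :
  \int[leb]_(s in `[0, 1]) Num.min s (nested_reflection e g s) =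
  1 / 4 + g ^+ 2 / 2 + e - e ^+ 2.
Proof.
have mf : measurable_fun setT (fun s : R => Num.min s (nested_reflection e g s)).
  by apply: measurable_minr => //; exact: measurable_nested_reflection.
have fM s : 0 <= s <= 1 -> `|Num.min s (nested_reflection e g s)| <= 1.
  move=> s01; have /andP[f0 _] := nested_reflection01 e0 g0 eg s01.
  have /andP[s0 s1] := s01.
  by rewrite ger0_norm ?le_min ?s0 ?f0// ge_min s1.
have split_at a b c := @integral_split _ _ 1 mf fM a b c.
have piece a b alpha beta := @integral_eq_affine _ _ 1 mf fM a b alpha beta.
have vals := min_nested_reflection e0 g0 eg.
rewrite (split_at 0 (2^-1 - g / 2) 1); try lra.
rewrite (split_at (2^-1 - g / 2) 2^-1 1); try lra.
rewrite (split_at 2^-1 (2^-1 + g / 2) 1); try lra.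
rewrite (split_at (2^-1 + g / 2) (2^-1 + g) 1); try lra.
rewrite (split_at (2^-1 + g) (1 - e) 1); try lra.
rewrite (piece 0 (2^-1 - g / 2) 1 0); [|lra|lra|lra|]; last first.
  by move=> s Hs; have [V _ _ _] := vals s; rewrite V ?Hs//; ring.
rewrite (piece (2^-1 - g / 2) 2^-1 (-1) (1 - g)); [|lra|lra|lra|]; last first.
  by move=> s Hs; have [_ V _ _] := vals s; rewrite V//; ring.
rewrite (piece 2^-1 (2^-1 + g / 2) 1 0); [|lra|lra|lra|]; last first.
  by move=> s Hs; have [V _ _ _] := vals s; rewrite V ?Hs ?orbT//; ring.
rewrite (piece (2^-1 + g / 2) (2^-1 + g) (-1) (1 + g)); [|lra|lra|lra|]; last first.
  by move=> s Hs; have [_ _ V _] := vals s; rewrite V//; ring.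
rewrite (piece (2^-1 + g) (1 - e) (-1) 1); [|lra|lra|lra|]; last first.
  by move=> s Hs; have [_ _ _ V] := vals s; rewrite V//; ring.
rewrite (piece (1 - e) 1 1 0); [|lra|lra|lra|]; last first.
  by move=> s Hs; have [V _ _ _] := vals s; rewrite V ?Hs ?orbT//; ring.
by field.
Qed.

(** Obtained through [integral_min] as a mean along the graph, without a formula for the diagonal
    section. *)
Lemma diagonal_integral_lower (e g : R) (e0 : 0 <= e) (g0 : 0 <= g)
    (eg : e + g <= 2^-1) :
  diagonal_integral (lower_law e g) = 1 / 4 + g ^+ 2 / 2 + e - e ^+ 2.
Proof.
have PU := uniform_marginals_lower_law e0 g0 eg.
rewrite -(integral_min PU) -integral_min_nested_reflection// /Rintegral; congr fine.
have mf : measurable_fun setT (fun s : R => Num.min s (nested_reflection e g s)).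
  by apply: measurable_minr => //; exact: measurable_nested_reflection.
rewrite [LHS]ge0_integral_pushforward//=; last 4 first.
- by apply: measurable_fun_pair => //; exact: measurable_nested_reflection.
- exact: measurable_unit_square.
- by apply/measurable_EFinP/measurable_funTS; exact: measurable_minimum.
- by move=> x /set_mem/unit_squareP[/andP[x0 _] /andP[y0 _]]; rewrite lee_fin le_min x0.
rewrite -[RHS]integral_unif; last 2 first.
- exact/measurable_EFinP.
- move=> s s01; have /andP[f0 _] := nested_reflection01 e0 g0 eg s01.
  by rewrite lee_fin le_min f0 andbT; case/andP: s01.
congr (integral _ _ _); apply/seteqP; split => s.
  by move=> /unit_squareP[].
rewrite /= in_itv/= => s01; split; rewrite /= in_itv/=//.
exact: nested_reflection01.
Qed.
End lower_extremal.

(** * Attainability of all admissible triples *)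

Section attainability.
Variable R : realType.

Lemma lower_copula_exists (d m : R) : 0 <= d <= 2^-1 ->
  1 / 4 + d ^+ 2 / 2 <= m <= 1 / 4 + d - d ^+ 2 ->
  exists P : probability (R * R)%type R,
  [/\ uniform_marginals P, cdf2 P 2^-1 2^-1 = d, diagonal_integral P = m &
      concordance_integral P = 2 * m - 1 / 2].
Proof.
move=> /andP[d0 d2] /andP[mL mU].
(* With [g = d - e], the equation [m = 1 / 4 + g ^+ 2 / 2 + e - e ^+ 2] reads
   [(1 - d - e) ^+ 2 = K]; the root taken is [e = 1 - d - r]. *)
pose K := (1 - d) ^+ 2 - 2 * m + 1 / 2 + d ^+ 2.
(* The upper bound on [m] gives [K1], hence [0 <= g]; the lower bound gives [K2], hence [0 <= e]. *)
have K1 : (1 - 2 * d) ^+ 2 <= K by rewrite /K; nra.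
have K0 : 0 <= K by apply: le_trans K1; exact: sqr_ge0.
have K2 : K <= (1 - d) ^+ 2 by rewrite /K; lra.
pose r := Num.sqrt K.
have r2 : r ^+ 2 = K by rewrite sqr_sqrtr.
have r_le : r <= 1 - d.
  rewrite -(ger0_norm (_ : 0 <= 1 - d)); last by lra.
  by rewrite -sqrtr_sqr ler_wsqrtr.
have r_ge : 1 - 2 * d <= r.
  rewrite -(ger0_norm (_ : 0 <= 1 - 2 * d)); last by lra.
  by rewrite -sqrtr_sqr ler_wsqrtr.
pose e := 1 - d - r; pose g := d - e.
have e0 : 0 <= e by rewrite /e; lra.
have g0 : 0 <= g by rewrite /g /e; lra.
have eg : e + g <= 2^-1 by rewrite /g; lra.
have mE : diagonal_integral (lower_law e g) = m.
  rewrite diagonal_integral_lower//.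
  rewrite (_ : m = ((1 - d) ^+ 2 + 1 / 2 + d ^+ 2 - r ^+ 2) / 2).
    by rewrite /g /e; field.
  by rewrite r2 /K; field.
exists (lower_law e g); split => //.
- exact: uniform_marginals_lower_law.
- by rewrite cdf2_lower_half// /g; ring.
- by rewrite concordance_integral_lower// mE.
Qed.

Lemma copula_exists (d m c : R) : 0 <= d <= 2^-1 ->
  1 / 4 + d ^+ 2 / 2 <= m <= 1 / 4 + d - d ^+ 2 ->
  2 * m - 1 / 2 <= c <= m ->
  exists P : probability (R * R)%type R,
  [/\ uniform_marginals P, cdf2 P 2^-1 2^-1 = d, diagonal_integral P = m &
      concordance_integral P = c].
Proof.
move=> d01 mLU /andP[cL cU].
have [P [PU Pd Pm Pc]] := lower_copula_exists d01 mLU.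
have [Q [QU QP Qc]] := upper_copula_exists PU.
have diag_eq (Q' : probability (R * R)%type R) :
    (forall u, 0 <= u <= 1 -> cdf2 Q' u u = cdf2 P u u) -> diagonal_integral Q' = m.
  move=> H; rewrite -Pm; apply: eq_Rintegral => u /set_mem.
  by rewrite /= in_itv/=; exact: H.
rewrite (diag_eq Q QP) in Qc.
pose A := concordance_integral Q; pose B := \int[Q]_(x in unit_square) cdf2 P x.1 x.2.
pose B' := \int[P]_(x in unit_square) cdf2 Q x.1 x.2.
pose E := concordance_integral P.
(* [h l] is the concordance integral of the mixture with weight [l] on [Q]: it equals
   [2 * m - 1 / 2] at 0 and [m] at 1. *)
pose h (l : R) := l * (l * A + (1 - l) * B) + (1 - l) * (l * B' + (1 - l) * E).
have hp : h = horner ('X * ('X * A%:P + (1 - 'X) * B%:P) +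
                      (1 - 'X) * ('X * B'%:P + (1 - 'X) * E%:P)).
  by apply/funext => l; rewrite /h !(hornerD, hornerM, hornerN, hornerX, hornerC).
have [||l l01 hl] := @IVT R h 0 1 c ler01.
- by rewrite hp; apply: continuous_subspaceT; exact: continuous_horner.
- rewrite /h !(mul0r, mul1r, subr0, subrr, add0r, addr0) /A /E Qc Pc.
  by rewrite ge_min le_max cL cU orbT.
have {}l01 : 0 <= l <= 1 by move: l01; rewrite in_itv.
have half01 : 0 <= (2^-1 : R) <= 1 by lra.
(* All mixtures share the diagonal of [P], so [d] and [m] are kept while the concordance integral
   varies. *)
have diag u : 0 <= u <= 1 -> cdf2 (mixture l01 Q P) u u = cdf2 P u u.
  by move=> u01; rewrite cdf2_mixture QP//; ring.
exists (mixture l01 Q P); split.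
- exact: uniform_marginals_mixture.
- by rewrite diag.
- exact: diag_eq.
- by rewrite concordance_integral_mixture -hl.
Qed.
End attainability.

Theorem theorem1p1 (R : realType) :
  [set (kendall_tau C, spearman_footrule C, blomqvist_beta C)
    | C in [set: copula R]] =
  [set x : R * R * R | let: (t, p, b) := x in
    [/\ -1 <= b <= 1,
        footrule_lower b <= p <= footrule_upper b &
        tau_lower p <= t <= tau_upper p]].
Proof.
apply/seteqP; split => [_ [C _ <-]|[[t p] b] [b01]].
  have [PU -> -> ->] := copula_functionalsE
    (fun A (_ : measurable A) => erefl (copula_measure C A)).
  have := cdf2_half_bounds PU; have := diagonal_integral_le PU.
  have := diagonal_integral_ge PU; have := concordance_integral_le PU.
  have := concordance_integral_ge PU.
  set d := cdf2 _ _ _; set m := diagonal_integral _; set c := concordance_integral _.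
  move=> c1 c2 m1 m2 d01.
  rewrite /footrule_lower /footrule_upper /tau_lower /tau_upper.
  by split; lra.
rewrite /footrule_lower /footrule_upper /tau_lower /tau_upper => p01 t01.
(* The arguments solve [b = 4 * d - 1], [p = 6 * m - 2] and [t = 4 * c - 1]. *)
have [|||P [PU Pd Pm Pc]] := @copula_exists R ((1 + b) / 4) ((p + 2) / 6) ((t + 1) / 4).
- by lra.
- by lra.
- by lra.
have [C CP] := copula_of_marginals PU.
exists C => //; have [_ -> -> ->] := copula_functionalsE CP.
by rewrite Pd Pm Pc; congr (_, _, _); field.
Qed.
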